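(* The number of Sidon subsets of $[n]$ is at least $2^{(1.16+o(1))\sqrt n}$ and at most $2^{(55+o(1))\sqrt n}$, where $o(1)\to0$ as $n\to\infty$.
   Context: A set $S\subset[n]=\{1,\dots,n\}$ is a Sidon set if all sums of two elements of $S$ are distinct, i.e. there are no $w,x,y,z\in S$ with $w+x=y+z$ and $\{w,x\}\ne\{y,z\}$. *)

(* Defs.v *)
From mathcomp Require Import all_boot.
Set Implicit Arguments.
Unset Strict Implicit.
Unset Printing Implicit Defensive.

(* [n] = {1, ..., n} is carved out of 'I_n.+1 = {0, ..., n}, so that elements
   keep their own values; sums are taken in nat, not modulo n.+1. *)
Definition interval1 (n : nat) : {set 'I_n.+1} := [set i : 'I_n.+1 | 0 < i].

Definition sidon (n : nat) (S : {set 'I_n.+1}) : bool :=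
  ~~ [exists w in S, exists x in S, exists y in S, exists z in S,
        (nat_of_ord w + nat_of_ord x == nat_of_ord y + nat_of_ord z)
        && ([set w; x] != [set y; z])].

Definition num_sidon (n : nat) : nat :=
  #|[set S : {set 'I_n.+1} | (S \subset interval1 n) && sidon S]|.

(* Main.v *)
Require Import Defs.
From mathcomp Require Import all_boot all_order all_algebra.
From mathcomp Require Import finfield cyclic.
From mathcomp Require Import all_classical all_reals all_analysis.
From mathcomp Require Import ring lra zify.
Set Implicit Arguments.
Unset Strict Implicit.
Unset Printing Implicit Defensive.
Import Order.TTheory GRing.Theory Num.Theory numFieldNormedType.Exports.
Local Open Scope ring_scope.

(* Lower bound.  If [B] is a Sidon set modulo [m], then choosing at most one
   representative in [1, 4m] of each element of [B] always gives a Sidon set.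
   For a prime [p] with primitive root [g], Ruzsa's set of the solutions of
   [x = i mod p-1, x = g^i mod p] is a Sidon set with [p-1] elements modulo
   [m = p(p-1)], so there are at least [5^(p-1)] Sidon subsets as soon as
   [4m <= n]; and [log_2 5 / 2 > 1.16].  Choosing [p] close to [sqrt n / 2]
   requires a prime in [(x, (1+eps)x]] for all large [x].  This follows from
   Selberg's symmetry formula: if an interval around [X] is free of primes, the
   formula makes the sum of [a(t) w(X/t)] over a logarithmic grid nearly maximal,
   where [a] and [w] are local densities of primes, bounded by [2] and of mean
   [1]; by AM-GM, [w] is then close to [0] or [2] almost everywhere.  But [w] has
   mean [1] on long blocks (Mertens) and varies slowly, so it spends a positive
   proportion of the scales near [1].

   Upper bound.  Given a Sidon set [S], join [x] and [y] when [x + a = y + b] with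
   [a], [b] in [S]: a Sidon set containing [S] adds to it an independent set of this
   graph.  Distinct pairs of [S] have distinct differences, so by Cauchy-Schwarz
   every vertex set with much more than [n / #|S|] elements spans a vertex of
   large degree, and the graph container argument bounds the number of extensions
   of [S] to twice its size.  Iterating the doubling gives a geometric series. *)

(** * Arithmetic functions *)

(** Four lifts per residue is the best number: [k] lifts give the exponent [log_2 (k + 1) / sqrt k],
    largest at [k = 4]. Its value [1.1609...] leaves so little room above [1.16] that [p] must
    approximate [sqrt n / 2] to within 0.06 percent; a prime known only to lie in [(x, 2x]] could
    lose half of the exponent.

    The densities live at two scales: [a] on cells of logarithmic length [l], [w] on blocks of fixed
    length [H] made of many cells. The order of choice matters: [H] bounds the speed of [w], hence
    fixes a proportion of scales spent near 1; only then are the tolerance [eta] and the mesh [l]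
    chosen, small against that proportion. The outcome is a positive share of von Mangoldt mass in
    every far block, and this share outweighs the proper prime powers.

    Sidon sets with fewer than about [n ^ (3/8)] elements are counted trivially, and doubling starts
    there. Adding [t] elements costs [exp (8 n^(1/4) sqrt t)] up to smaller factors; the geometric
    series turns 8 into 20, the maximal size, about [2 sqrt n], turns 20 into 29, and lower order
    factors fit into [exp (34 sqrt n)], where [34 / ln 2 < 55]. *)

Lemma mem_divisors_pfactor (p a m d : nat) : prime p -> (0 < m)%N ->
  ~~ (p %| m)%N ->
  (d \in divisors (p ^ a * m)) =
  (d \in [seq (p ^ j * e)%N | j <- iota 0 a.+1, e <- divisors m]).
Proof.
move=> pp m0 pm.
have pm0 : (0 < p ^ a * m)%N by rewrite muln_gt0 expn_gt0 prime_gt0.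
rewrite -dvdn_divisors //.
apply/idP/allpairsP => [dn|[[j e] [jI eD ->]]]; last first.
  move: jI eD; rewrite mem_iota -dvdn_divisors //= add0n ltnS => ja em.
  by rewrite dvdn_mul ?dvdn_exp2l.
have d0 : (0 < d)%N by exact: dvdn_gt0 dn.
have [e pe de] := pfactor_coprime pp d0.
exists (logn p d, e); split; last by rewrite mulnC.
- rewrite mem_iota /= add0n ltnS.
  apply: leq_trans (dvdn_leq_log p pm0 dn) _.
  rewrite lognM ?expn_gt0 ?(prime_gt0 pp) // pfactorK //.
  by rewrite (@logn_coprime p m) ?addn0 // prime_coprime.
- rewrite /= -dvdn_divisors // -(@Gauss_dvdr _ (p ^ a)); last first.
    by rewrite coprime_sym coprimeXl.
  by apply: dvdn_trans dn; rewrite de dvdn_mulr.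
Qed.

Lemma sum_divisors_pfactor {R : zmodType} (f : nat -> R) (p a m : nat) :
  prime p -> (0 < m)%N -> ~~ (p %| m)%N ->
  \sum_(d <- divisors (p ^ a * m)) f d =
  \sum_(0 <= j < a.+1) \sum_(d <- divisors m) f (p ^ j * d)%N.
Proof.
move=> pp m0 pm.
rewrite (perm_big [seq (p ^ j * e)%N | j <- iota 0 a.+1, e <- divisors m]).
  by rewrite big_allpairs_dep /= /index_iota subn0.
apply: uniq_perm; first exact: divisors_uniq.
- apply: allpairs_uniq; [exact: iota_uniq|exact: divisors_uniq|].
  move=> ? ? /allpairsPdep[x [y [_ yD ->]]].
  move=> /allpairsPdep[x' [y' [_ yD' ->]]] /= E.
  have cop z : z \in divisors m -> (0 < z)%N /\ logn p z = 0%N.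
    rewrite -dvdn_divisors // => zm; split; first exact: dvdn_gt0 zm.
    rewrite logn_coprime // prime_coprime //.
    by apply: contra pm => /dvdn_trans; apply.
  have [y0 ly] := cop _ yD. have [y0' ly'] := cop _ yD'.
  have Ex : x = x'.
    have := congr1 (logn p) E.
    by rewrite !lognM ?expn_gt0 ?(prime_gt0 pp) // !pfactorK // ly ly' !addn0.
  move: E => /eqP; rewrite Ex eqn_pmul2l ?expn_gt0 ?(prime_gt0 pp) // => /eqP->.
  by [].
- by move=> d; exact: mem_divisors_pfactor.
Qed.

(** Stands in for multiplicativity: a divisor sum over [n] is computed by splitting off the full
    power of one prime and reducing to the cofactor [m]. *)
Lemma prime_split (n : nat) : (1 < n)%N -> exists p a m,
  [/\ prime p, (0 < m < n)%N, ~~ (p %| m)%N & n = (p ^ a.+1 * m)%N].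
Proof.
move=> n1; have n0 := ltnW n1; have pp := pdiv_prime n1.
have [m pm En] := pfactor_coprime pp n0.
have l0 : (0 < logn (pdiv n) n)%N by rewrite logn_gt0 pi_pdiv.
have m0 : (0 < m)%N by move: n0; rewrite En muln_gt0 => /andP[].
exists (pdiv n), (logn (pdiv n) n).-1, m; split => //.
- rewrite m0 /= [X in (_ < X)%N]En ltn_Pmulr //.
  by rewrite -(prednK l0) (leq_trans (prime_gt1 pp)) // expnS leq_pmulr // expn_gt0 prime_gt0.
- by rewrite -prime_coprime.
- by rewrite prednK // mulnC.
Qed.

Definition mobius {R : pzRingType} (n : nat) : R :=
  if all (fun p => logn p n == 1%N) (primes n) then (-1) ^+ size (primes n) else 0.

Definition von_mangoldt {R : realType} (n : nat) : R :=
  if (1 < n)%N && (n == pdiv n ^ logn (pdiv n) n)%N then ln (pdiv n)%:R else 0.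

Section Moebius.
Context {R : realType}.
Local Notation mu := (@mobius R).
Local Notation Lam := (@von_mangoldt R).

Lemma mobius_norm_le1 (n : nat) : `|mu n| <= 1.
Proof.
rewrite /mobius; case: ifP => _; last by rewrite normr0 ler01.
by rewrite normrX normrN1 expr1n.
Qed.

Lemma primes_pmul (p d : nat) : prime p -> (0 < d)%N -> ~~ (p %| d)%N ->
  perm_eq (primes (p * d)) (p :: primes d).
Proof.
move=> pp d0 pd; apply: uniq_perm; rewrite ?primes_uniq //=.
  by rewrite primes_uniq andbT mem_primes pp d0.
move=> q; rewrite primesM ?(prime_gt0 pp) // inE; congr (_ || _).
by rewrite primes_prime // inE.
Qed.

Lemma mobius_pmul (p d : nat) : prime p -> (0 < d)%N -> ~~ (p %| d)%N ->
  mu (p * d) = - mu d.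
Proof.
move=> pp d0 pd; have P := primes_pmul pp d0 pd.
rewrite /mobius (perm_size P) (perm_all _ P) /=.
have -> : logn p (p * d) = 1%N.
  by rewrite lognM ?(prime_gt0 pp) // logn_prime // eqxx (@logn_coprime p d) // prime_coprime.
rewrite eqxx /=.
have -> : all (fun p0 : nat => logn p0 (p * d) == 1%N) (primes d) =
   all (fun p0 : nat => logn p0 d == 1%N) (primes d).
  apply: eq_in_all => q qd; rewrite lognM ?(prime_gt0 pp) // logn_prime //.
  have -> : (q == p) = false.
    by apply: contraNF pd => /eqP<-; move: qd; rewrite mem_primes => /and3P[].
  by [].
by case: ifP => _; rewrite ?oppr0 // exprS mulN1r.
Qed.

Lemma mobius_psq (p j d : nat) : prime p -> (0 < d)%N -> mu (p ^ j.+2 * d) = 0.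
Proof.
move=> pp d0; rewrite /mobius; case: ifP => // /allP /(_ p).
rewrite mem_primes pp muln_gt0 expn_gt0 prime_gt0 // d0 /=.
rewrite dvdn_mulr ?dvdn_exp // => /(_ isT).
by rewrite lognM ?expn_gt0 ?(prime_gt0 pp) // pfactorK.
Qed.

(** Exponents of [p] above 1 kill [mu], and the exponents 0 and 1 pair off with opposite signs. A
    constant [g] then gives 0, while [g = ln] leaves [- ln p] times the sum of [mu] over the
    divisors of [m]. *)
Lemma sum_mobius_pfactor (g : nat -> R) (p a m : nat) :
  prime p -> (0 < m)%N -> ~~ (p %| m)%N ->
  \sum_(d <- divisors (p ^ a.+1 * m)) mu d * g d =
  \sum_(d <- divisors m) mu d * (g d - g (p * d)%N).
Proof.
move=> pp m0 pm; rewrite sum_divisors_pfactor // big_nat_recl // big_nat_recl //.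
rewrite [X in _ + (_ + X)]big1_seq ?addr0 => [|j _]; last first.
  rewrite big1_seq // => d /andP[_]; rewrite -dvdn_divisors // => dm.
  by rewrite mobius_psq ?mul0r //; exact: dvdn_gt0 dm.
rewrite -big_split /=; apply: eq_big_seq => d; rewrite -dvdn_divisors // => dm.
rewrite mul1n expn1 mobius_pmul //; first by rewrite mulrBr mulNr.
- exact: dvdn_gt0 dm.
- by apply: contra pm => /dvdn_trans; apply.
Qed.

Lemma sum_mobius (n : nat) : (0 < n)%N -> \sum_(d <- divisors n) mu d = (n == 1%N)%:R.
Proof.
have [|n1 _|-> _] := ltngtP n 1%N; [by case: n | | by rewrite /divisors /= big_seq1 /mobius].
have [p [a [m [pp /andP[m0 _] pm ->]]]] := prime_split n1.
have := sum_mobius_pfactor (fun=> 1) a pp m0 pm.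
under eq_bigr do rewrite mulr1.
move=> ->; rewrite big1 => [|d _]; last by rewrite subrr mulr0.
have : (1 < p ^ a.+1)%N by rewrite -(exp1n a.+1) ltn_exp2r // prime_gt1.
by move: m0 {pm}; case: m => // m _; nia.
Qed.

Lemma von_mangoldt1 : Lam 1 = 0. Proof. by []. Qed.

Lemma von_mangoldt_pfactor (p k : nat) : prime p -> Lam (p ^ k.+1) = ln p%:R.
Proof.
move=> pp; rewrite /von_mangoldt pdiv_pfactor // pfactorK // eqxx andbT.
by rewrite -[X in (X < _)%N](exp1n k.+1) ltn_exp2r // prime_gt1.
Qed.

Lemma von_mangoldt_pfactorM (p k m : nat) : prime p -> (1 < m)%N -> ~~ (p %| m)%N ->
  Lam (p ^ k.+1 * m) = 0.
Proof.
move=> pp m1 pm; rewrite /von_mangoldt; case: ifP => // /andP[n1 /eqP E].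
have rp := pdiv_prime n1.
have D q : prime q -> (q %| p ^ k.+1 * m)%N -> q = pdiv (p ^ k.+1 * m).
  by move=> qp; rewrite [X in (_ %| X)%N]E Euclid_dvdX // => /andP[]; rewrite dvdn_prime2 // => /eqP.
have e1 : p = pdiv (p ^ k.+1 * m) by apply: D; rewrite // dvdn_mulr // dvdn_exp.
have e2 : pdiv m = pdiv (p ^ k.+1 * m).
  by apply: D; rewrite ?pdiv_prime // dvdn_mull // pdiv_dvd.
by move: pm; rewrite e1 -e2 pdiv_dvd.
Qed.

Lemma von_mangoldt_ge0 (n : nat) : 0 <= Lam n.
Proof.
rewrite /von_mangoldt; case: ifP => // /andP[n1 _].
by rewrite ln_ge0 // ler1n pdiv_gt0.
Qed.

Lemma sum_von_mangoldt (n : nat) : (0 < n)%N -> \sum_(d <- divisors n) Lam d = ln n%:R.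
Proof.
elim/ltn_ind: n => n IH; have [|n1 _|-> _] := ltngtP n 1%N;
  [by case: (n) | | by rewrite /divisors /= big_seq1 von_mangoldt1 ln1].
have [p [a [m [pp /andP[m0 mn] pm En]]]] := prime_split n1.
have p0 := prime_gt0 pp.
rewrite {1}En sum_divisors_pfactor // big_nat_recl //.
have -> : \sum_(d <- divisors m) Lam (p ^ 0 * d) = ln m%:R.
  by rewrite -IH //; apply: eq_bigr => d _; rewrite expn0 mul1n.
rewrite (eq_big_nat _ _ (F2 := fun=> ln p%:R)) => [|j _]; last first.
  rewrite (perm_big (1%N :: [seq d <- divisors m | d != 1%N])); last first.
    apply: uniq_perm; rewrite ?divisors_uniq //=.
      by rewrite mem_filter /= filter_uniq // divisors_uniq.
    move=> d; rewrite inE mem_filter; case: eqP => // ->.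
    by rewrite -dvdn_divisors // dvd1n.
  rewrite big_cons muln1 von_mangoldt_pfactor // big1_seq /= ?addr0 // => d /=.
  rewrite mem_filter -dvdn_divisors // => /andP[d1 dm].
  have d0 : (0 < d)%N := dvdn_gt0 m0 dm.
  rewrite von_mangoldt_pfactorM //; first by lia.
  by apply: contra pm => /dvdn_trans; apply.
rewrite sumr_const_nat subn0 En natrM lnM ?posrE ?ltr0n ?expn_gt0 ?p0 //.
by rewrite natrX lnXn ?ltr0n // addrC.
Qed.

Lemma sum_mobius_ln (n : nat) : (0 < n)%N ->
  \sum_(d <- divisors n) mu d * ln d%:R = - Lam n.
Proof.
have [|n1 _|-> _] := ltngtP n 1%N; [by case: n | | by rewrite /divisors /= big_seq1 ln1 mulr0 von_mangoldt1 oppr0].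
have [p [a [m [pp /andP[m0 _] pm ->]]]] := prime_split n1.
have p0 := prime_gt0 pp.
rewrite (sum_mobius_pfactor (fun d => ln d%:R)) //.
rewrite (eq_big_seq (fun d => mu d * - ln p%:R)) => [|d]; last first.
  rewrite -dvdn_divisors // => dm; have d0 : (0 < d)%N := dvdn_gt0 m0 dm.
  by rewrite natrM lnM ?posrE ?ltr0n // opprD addrCA subrr addr0.
rewrite -big_distrl /= sum_mobius //.
have [->|m1] := eqVneq m 1%N; first by rewrite muln1 von_mangoldt_pfactor // mul1r.
by rewrite von_mangoldt_pfactorM ?mul0r ?oppr0 //; lia.
Qed.

End Moebius.

(** * Chebyshev, Mertens and Selberg *)

Lemma big_divisors_nat {R : nmodType} (f : nat -> R) (n : nat) : (0 < n)%N ->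
  \sum_(d <- divisors n) f d = \sum_(1 <= d < n.+1 | (d %| n)%N) f d.
Proof.
move=> n0; rewrite -[RHS]big_filter; apply: perm_big; apply: uniq_perm.
- exact: divisors_uniq.
- by rewrite filter_uniq // iota_uniq.
- move=> d; rewrite mem_filter -dvdn_divisors // mem_index_iota ltnS.
  by case: (boolP (d %| n)%N) => //= dn; rewrite (dvdn_gt0 n0 dn) (dvdn_leq n0 dn).
Qed.

Lemma sum_divisors_exchange {R : nmodType} (f : nat -> nat -> R) (N : nat) :
  \sum_(1 <= k < N.+1) \sum_(d <- divisors k) f d k =
  \sum_(1 <= d < N.+1) \sum_(1 <= m < (N %/ d).+1) f d (d * m)%N.
Proof.
elim: N => [|N IH]; first by rewrite !big_geq.
rewrite big_nat_recr //= IH.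
have -> : \sum_(1 <= d < N.+1) \sum_(1 <= m < (N %/ d).+1) f d (d * m)%N =
    \sum_(1 <= d < N.+2) \sum_(1 <= m < (N %/ d).+1) f d (d * m)%N.
  by rewrite [RHS]big_nat_recr //= divn_small // [in X in _ + X]big_geq // addr0.
rewrite big_divisors_nat // [X in _ + X = _]big_mkcond -big_split /=.
apply: eq_big_nat => d /andP[d0 _]; rewrite divnS //.
case: ifP => [dN|_]; last by rewrite add0n addr0.
rewrite add1n [in RHS]big_nat_recr //=; congr (_ + f _ _).
by have := divnS N d0; rewrite dN add1n => <-; rewrite mulnC divnK.
Qed.

Lemma hyperbola_swap {R : nmodType} (f : nat -> nat -> R) (N : nat) :
  \sum_(1 <= d < N.+1) \sum_(1 <= m < (N %/ d).+1) f d m =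
  \sum_(1 <= m < N.+1) \sum_(1 <= d < (N %/ m).+1) f d m.
Proof.
have E (g : nat -> R) d : (0 < d)%N -> \sum_(1 <= m < (N %/ d).+1) g m =
    \sum_(1 <= m < N.+1 | (d * m <= N)%N) g m.
  move=> d0; rewrite (big_nat_widen _ _ N.+1) ?ltnS ?leq_div //.
  by apply: eq_bigl => m; rewrite ltnS leq_divRL // mulnC.
under eq_big_nat => d /andP[d0 _] do rewrite E //.
under [RHS]eq_big_nat => d /andP[d0 _] do rewrite E //.
rewrite (exchange_big_dep predT) //=; apply: eq_big_nat => m _.
by apply: eq_bigl => d; rewrite mulnC.
Qed.

Section Chebyshev.
Context {R : realType}.
Local Notation mu := (@mobius R).
Local Notation Lam := (@von_mangoldt R).

Definition psi (N : nat) : R := \sum_(1 <= k < N.+1) Lam k.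
Definition lnfact (N : nat) : R := \sum_(1 <= k < N.+1) ln k%:R.

Lemma psi0 : psi 0 = 0. Proof. by rewrite /psi big_geq. Qed.

Lemma psiS (N : nat) : psi N.+1 = psi N + Lam N.+1.
Proof. by rewrite /psi big_nat_recr. Qed.

Lemma psi_homo : {homo psi : m n / (m <= n)%N >-> m <= n}.
Proof.
move=> m n /subnK <-; elim: (n - m)%N => // k IH.
by rewrite addSn psiS (le_trans IH) // lerDl von_mangoldt_ge0.
Qed.

Lemma psi_ge0 (N : nat) : 0 <= psi N.
Proof. by rewrite -psi0 psi_homo. Qed.

Lemma lnfactE (N : nat) : lnfact N = \sum_(1 <= k < N.+1) Lam k * (N %/ k)%:R.
Proof.
rewrite /lnfact (eq_big_nat _ _ (F2 := fun k => \sum_(d <- divisors k) Lam d)).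
  rewrite (sum_divisors_exchange (fun d _ => Lam d)).
  by apply: eq_bigr => d _; rewrite sumr_const_nat subn1 mulr_natr.
by move=> k /andP[k0 _]; rewrite sum_von_mangoldt.
Qed.

Lemma lnfact_psi (N : nat) : lnfact N = \sum_(1 <= m < N.+1) psi (N %/ m).
Proof.
rewrite /psi -(hyperbola_swap (fun d _ => Lam d)) lnfactE.
by apply: eq_bigr => d _; rewrite sumr_const_nat subn1 mulr_natr.
Qed.

Lemma ln_leB1 (x : R) : 0 < x -> ln x <= x - 1.
Proof. by move=> x0; have := @le_ln1Dx R (x - 1); rewrite subrKC; apply; lra. Qed.

Lemma lnS_bound (n : nat) : (0 < n)%N ->
  n.+1%:R^-1 <= ln (n.+1%:R : R) - ln n%:R <= n%:R^-1.
Proof.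
move=> n0; have p0 : (0 : R) < n%:R by rewrite ltr0n.
have p1 : (0 : R) < n.+1%:R by rewrite ltr0n.
rewrite -ln_div ?posrE //; apply/andP; split.
  rewrite -[leRHS]opprK -lnV ?posrE ?divr_gt0 // lerNr invf_div.
  apply: le_trans (ln_leB1 _) _; first by rewrite divr_gt0.
  rewrite le_eqVlt; apply/orP; left; apply/eqP; rewrite -natr1; field.
  by rewrite natr1 gt_eqF.
apply: le_trans (ln_leB1 _) _; first by rewrite divr_gt0.
by rewrite le_eqVlt; apply/orP; left; apply/eqP; rewrite -natr1; field; rewrite gt_eqF.
Qed.

Lemma lnfact_bound (n : nat) : (0 < n)%N ->
  n%:R * ln n%:R - n%:R + 1 <= lnfact n <= n%:R * ln n%:R - n%:R + 1 + ln n%:R.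
Proof.
elim: n => // -[_ _|n IH _]; first by rewrite /lnfact big_nat1 ln1; lra.
have /andP[h1 h2] := IH isT.
have /andP[l1 l2] := @lnS_bound n.+1 isT.
rewrite /lnfact big_nat_recr //= -/(lnfact n.+1).
set a := ln n.+1%:R in h1 h2 l1 l2 *; set b := ln n.+2%:R in l1 l2 *.
have p1 : (0 : R) < n.+1%:R by rewrite ltr0n.
have p2 : (0 : R) < n.+2%:R by rewrite ltr0n.
have {}l1 : 1 <= (b - a) * n.+2%:R by rewrite -ler_pdivrMr // div1r.
have {}l2 : (b - a) * n.+1%:R <= 1 by rewrite -ler_pdivlMr // div1r.
have e : n.+2%:R = n.+1%:R + 1 :> R by rewrite natr1.
rewrite e in l1 *; apply/andP; split; nra.
Qed.

Lemma ln_natr_ge0 (n : nat) : 0 <= ln n%:R :> R.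
Proof. by case: n => [|n]; [rewrite ln0|rewrite ln_ge0 // ler1n]. Qed.

(* [N %/ k - 2 * (N %/ 2 %/ k)] is the parity of [N %/ k], and is [1] for
   [N / 2 < k <= N]. *)
Lemma psi_half (N : nat) : psi N - psi (N %/ 2) <= lnfact N - 2 * lnfact (N %/ 2).
Proof.
have hN : (N %/ 2 <= N)%N by rewrite leq_div.
rewrite !lnfactE mulr_sumr.
have -> : \sum_(1 <= k < (N %/ 2).+1) 2 * (Lam k * (N %/ 2 %/ k)%:R) =
   \sum_(1 <= k < N.+1) 2 * (Lam k * (N %/ 2 %/ k)%:R).
  rewrite [RHS](big_cat_nat (n := (N %/ 2).+1)) //= [X in _ = _ + X]big_nat_cond.
  rewrite [X in _ = _ + X]big1 ?addr0 // => k /andP[/andP[k1 k2] _].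
  by rewrite divn_small // mulr0 mulr0.
rewrite -sumrB /psi (big_cat_nat (n := (N %/ 2).+1)) //= addrAC subrr add0r.
rewrite [leRHS](big_cat_nat (n := (N %/ 2).+1)) //=.
have odd_part k : (N %/ k)%N = (2 * (N %/ 2 %/ k) + (N %/ k) %% 2)%N.
  by rewrite -divnMA mulnC [(2 * k)%N]mulnC divnMA -divn_eq.
rewrite -[leLHS]add0r; apply: lerD.
  apply: sumr_ge0 => k _; rewrite {1}odd_part natrD natrM.
  have := von_mangoldt_ge0 (R := R) k.
  by have : 0 <= ((N %/ k) %% 2)%:R :> R by []; nra.
rewrite big_nat_cond [leRHS]big_nat_cond; apply: ler_sum => k /andP[/andP[k1 k2] _].
have k0 : (0 < k)%N by apply: leq_trans k1.
rewrite (divn_small k1) mulr0 mulr0 subr0 ler_peMr ?von_mangoldt_ge0 // ler1n.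
by rewrite divn_gt0.
Qed.

(** Strong induction by halving: with [h = N %/ 2], [psi N - psi h] is bounded by
    [lnfact N - 2 * lnfact h], which is linear in [N] since [ln N - ln h <= (N - h) / h]. The
    constant 8 is generous and absorbs the logarithms and the parity of [N]. *)
Lemma psi_le (N : nat) : psi N <= 8 * N%:R.
Proof.
elim/ltn_ind: N => N IH; have [N1|N2] := leqP N 1.
  case: N N1 {IH} => [|[|]] // _; rewrite ?psi0 ?psiS ?psi0 ?von_mangoldt1; lra.
set h := (N %/ 2)%N; have h0 : (0 < h)%N by rewrite /h divn_gt0.
have hN : (h < N)%N by rewrite ltn_Pdiv // ltnW.
have := psi_half N; rewrite -/h.
have /andP[_ a2] := lnfact_bound (ltnW N2).
have /andP[b1 _] := lnfact_bound h0.
have := IH _ hN.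
have [e e1 eN] : exists2 e, (e <= 1)%N & N = (2 * h + e)%N.
  by exists (N %% 2)%N; [rewrite -ltnS ltn_pmod | rewrite mulnC -divn_eq].
have p0 : (0 : R) < N%:R by rewrite ltr0n ltnW.
have q0 : (0 : R) < h%:R by rewrite ltr0n.
have lN : ln N%:R <= N%:R - 1 :> R by exact: ln_leB1.
have lh : (ln N%:R - ln h%:R) * h%:R <= N%:R - h%:R :> R.
  rewrite -ln_div ?posrE // -ler_pdivlMr //.
  apply: le_trans (ln_leB1 _) _; first by rewrite divr_gt0.
  by rewrite mulrBl divff ?gt_eqF.
have lN0 := ln_natr_ge0 N.
have E : N%:R = 2 * h%:R + e%:R :> R by rewrite {1}eN natrD natrM.
have h1 : 1 <= h%:R :> R by rewrite ler1n.
have e0 : 0 <= e%:R :> R by [].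
have {}e1 : e%:R <= 1 :> R by rewrite lern1.
move: a2 b1 lN lh lN0 E h1 e0 e1 {p0 q0 IH}.
set A := ln N%:R; set B := ln h%:R; move: (N%:R : R) (h%:R : R) (e%:R : R) => n y z.
move=> a2 b1 lN lh lN0 E h1 e0 e1 c1 c2; rewrite E in a2 lh lN *.
have : z * A <= A by nra.
nra.
Qed.

(** In [lnfact N], the sum of [Lam k * (N %/ k)], removing the floors costs at most [psi N <= 8 N];
    and [lnfact N / N] is [ln N - 1] up to a bounded error. *)
Lemma mertens (N : nat) : (0 < N)%N ->
  `|\sum_(1 <= k < N.+1) Lam k / k%:R - ln N%:R| <= 10.
Proof.
move=> N0; set S := \sum_(_ <= _ < _) _.
have p0 : (0 : R) < N%:R by rewrite ltr0n.
have /andP[a1 a2] := lnfact_bound N0.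
have up : lnfact N <= N%:R * S.
  rewrite lnfactE /S mulr_sumr big_nat_cond [leRHS]big_nat_cond.
  apply: ler_sum => k /andP[/andP[k0 _] _].
  have q0 : (0 : R) < k%:R by rewrite ltr0n.
  rewrite mulrCA; apply: ler_wpM2l; first exact: von_mangoldt_ge0.
  by rewrite ler_pdivlMr // -natrM ler_nat leq_divM.
have lo : N%:R * S - psi N <= lnfact N.
  rewrite lnfactE /S mulr_sumr /psi -sumrB big_nat_cond [leRHS]big_nat_cond.
  apply: ler_sum => k /andP[/andP[k0 _] _].
  have q0 : (0 : R) < k%:R by rewrite ltr0n.
  rewrite mulrCA -[X in _ - X]mulr1 -mulrBr; apply: ler_wpM2l; first exact: von_mangoldt_ge0.
  rewrite lerBlDr ler_pdivrMr // natr1 -natrM ler_nat ltnW // ltn_ceil //.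
have := psi_le N => ps.
have lN : ln N%:R <= N%:R - 1 :> R by exact: ln_leB1.
have lN0 := ln_natr_ge0 N.
have N1 : 1 <= N%:R :> R by rewrite ler1n.
rewrite ler_norml; apply/andP; split; rewrite -(ler_pM2l p0); nra.
Qed.

End Chebyshev.

(** * Selberg's symmetry formula through the Tatuzawa-Iseki identity *)

Section Selberg.
Context {R : realType}.
Local Notation mu := (@mobius R).
Local Notation Lam := (@von_mangoldt R).
Local Notation psi := (@psi R).
Local Notation lnfact := (@lnfact R).

Definition harmonic (n : nat) : R := \sum_(1 <= k < n.+1) k%:R^-1.

(** [g] is Euler's constant, obtained as the supremum of the increasing sequence
    [harmonic n - ln n - 1/n], which stays below the decreasing sequence [harmonic n - ln n]. *)
Lemma harmonic_asymp : exists g : R, forall n, (0 < n)%N ->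
  ln n%:R + g <= harmonic n <= ln n%:R + g + n%:R^-1.
Proof.
pose u n := harmonic n.+1 - ln n.+1%:R.
pose v n := u n - n.+1%:R^-1.
have du n : u n.+1 <= u n.
  have := @lnS_bound R n.+1 isT => /andP[].
  set a := n.+2%:R^-1; set b := ln n.+2%:R; set c := ln n.+1%:R => h _.
  by rewrite /u /harmonic [in leLHS]big_nat_recr //= -addrA lerD2l -/a -/b -/c; lra.
have dv n : v n <= v n.+1.
  have := @lnS_bound R n.+1 isT => /andP[_].
  set a := n.+1%:R^-1; set b := ln n.+2%:R; set c := ln n.+1%:R => h.
  rewrite /v /u /harmonic [in leRHS]big_nat_recr //= -!addrA lerD2l -/a -/b -/c; set d := n.+2%:R^-1; lra.
have mu_ m n : (m <= n)%N -> u n <= u m.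
  by move=> /subnK <-; elim: (n - m)%N => // k IH; rewrite addSn (le_trans (du _)).
have mv m n : (m <= n)%N -> v m <= v n.
  by move=> /subnK <-; elim: (n - m)%N => // k IH; rewrite addSn (le_trans IH).
have vu m n : v m <= u n.
  apply: (@le_trans _ _ (v (maxn m n))); first by rewrite mv // leq_maxl.
  apply: (@le_trans _ _ (u (maxn m n))); last by rewrite mu_ // leq_maxr.
  by rewrite /v gerBl invr_ge0.
exists (sup (range v)%classic) => -[//|n] _.
have ub m : ubound (range v)%classic (u m) by move=> _ [k _ <-].
have s1 : v n <= sup (range v)%classic by apply: ub_le_sup; [exists (u 0%N)|exists n].
have s2 : sup (range v)%classic <= u n by apply: sup_le_ub; [exists (v 0%N), 0%N|].
move: s1 s2; rewrite {1}/v /u; set a := n.+1%:R^-1; set s := sup _.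
by move=> s1 s2; apply/andP; split; lra.
Qed.

(** Grouping by [k = d m], the coefficient of [F k] is the sum of [mu d * (ln N - ln d)] over the
    divisors of [k]: [ln N] if [k = 1], plus [Lam k]. *)
Lemma tatuzawa_iseki (F : nat -> R) (N : nat) : (0 < N)%N ->
  \sum_(1 <= d < N.+1) mu d * ln (N%:R / d%:R) *
     \sum_(1 <= m < (N %/ d).+1) F (d * m)%N =
  F 1%N * ln N%:R + \sum_(1 <= k < N.+1) F k * Lam k.
Proof.
move=> N0; have p0 : (0 : R) < N%:R by rewrite ltr0n.
transitivity (\sum_(1 <= k < N.+1) \sum_(d <- divisors k)
    mu d * ln (N%:R / d%:R) * F k).
  rewrite (sum_divisors_exchange (fun d k => mu d * ln (N%:R / d%:R) * F k)).
  by apply: eq_bigr => d _; rewrite mulr_sumr.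
transitivity (\sum_(1 <= k < N.+1) (F k * ((k == 1%N)%:R * ln N%:R) + F k * Lam k)).
  apply: eq_big_nat => k /andP[k0 kN].
  rewrite -mulr_suml -mulrDr mulrC; congr (_ * _).
  rewrite -sum_mobius // -[Lam k]opprK -sum_mobius_ln // mulr_suml -sumrB.
  apply: eq_big_seq => d; rewrite -dvdn_divisors // => dk.
  have d0 := dvdn_gt0 k0 dk.
  by rewrite ln_div ?posrE ?ltr0n // mulrBr.
rewrite big_split /=; congr (_ + _).
rewrite big_ltn // eqxx mul1r big_nat_cond big1 ?addr0 // => k /andP[/andP[k1 _] _].
by rewrite gtn_eqF // mul0r mulr0.
Qed.

Lemma sum_inv_sqrt (N : nat) :
  \sum_(1 <= d < N.+1) (Num.sqrt d%:R)^-1 <= 2 * Num.sqrt N%:R :> R.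
Proof.
elim: N => [|N IH]; first by rewrite big_geq // sqrtr0 mulr0.
rewrite big_nat_recr //=; apply: le_trans (lerD IH (lexx _)) _.
set a := Num.sqrt N%:R; set b := Num.sqrt N.+1%:R.
have a0 : 0 <= a by rewrite sqrtr_ge0.
have b0 : 0 < b by rewrite sqrtr_gt0.
have a2 : a ^+ 2 = N%:R by rewrite sqr_sqrtr.
have b2 : b ^+ 2 = N%:R + 1 by rewrite sqr_sqrtr // natr1.
have ab : a <= b by rewrite ler_sqrt // ler_nat.
rewrite -lerBrDl -[b^-1]div1r ler_pdivrMr //; nra.
Qed.

Lemma ln_le_2sqrt (x : R) : 1 <= x -> ln x <= 2 * Num.sqrt x.
Proof.
move=> x1; have x0 : 0 < x by lra.
have s0 : 0 < Num.sqrt x by rewrite sqrtr_gt0.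
rewrite -{1}(sqr_sqrtr (ltW x0)) lnXn // -mulr_natl.
by have := ln_leB1 s0; lra.
Qed.

(** Trades squared logarithms of [N / d] for [sqrt (N / d)], whose sum over [d <= N] is linear in
    [N], with no logarithm left. *)
Lemma ln_sqr_le (x : R) : 1 <= x -> ln x ^+ 2 <= 16 * Num.sqrt x.
Proof.
move=> x1; have x0 : 0 < x by lra.
have s1 : 1 <= Num.sqrt x by rewrite -sqrtr1 ler_wsqrtr.
have := ln_le_2sqrt s1; have := ln_ge0 s1.
set s := Num.sqrt x in s1 *.
have -> : ln x = 2 * ln s.
  by rewrite -{1}(sqr_sqrtr (ltW x0)) -/s lnXn ?mulr_natl //; lra.
have t2 : Num.sqrt s ^+ 2 = s by rewrite sqr_sqrtr //; lra.
move=> l0 l1; have := ler_pM l0 l0 l1 l1; rewrite expr2 in t2; rewrite expr2; nra.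
Qed.

(* With [c = gamma + 1], the terms [y ln y] and [y] of the three sums cancel. *)
Lemma tatuzawa_iseki_remainder : exists c K : R, forall N d : nat,
  (0 < d <= N)%N ->
  `|\sum_(1 <= m < (N %/ d).+1) (psi (N %/ (d * m)) - N%:R / (d * m)%:R + c)|
    <= 2 * ln (N%:R / d%:R) + K.
Proof.
have [g Hg] := harmonic_asymp.
exists (g + 1), (`|g| + 3) => N d /andP[d0 dN].
have N0 : (0 < N)%N by apply: leq_trans dN.
set M := (N %/ d)%N; have M0 : (0 < M)%N by rewrite divn_gt0.
have p0 : (0 : R) < d%:R by rewrite ltr0n.
have q0 : (0 : R) < M%:R by rewrite ltr0n.
set y : R := N%:R / d%:R.
have yM : M%:R <= y by rewrite ler_pdivlMr // -natrM ler_nat leq_divM.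
have yM1 : y <= M%:R + 1 by rewrite ler_pdivrMr // natr1 -natrM ler_nat ltnW // ltn_ceil.
have -> : \sum_(1 <= m < M.+1) (psi (N %/ (d * m)) - N%:R / (d * m)%:R + (g + 1)) =
   lnfact M - y * harmonic M + (g + 1) * M%:R.
  rewrite big_split /= sumrB sumr_const_nat subn1 mulr_natr; congr (_ - _ + _).
    by rewrite lnfact_psi; apply: eq_bigr => m _; rewrite divnMA.
  rewrite /harmonic mulr_sumr; apply: eq_bigr => m _.
  by rewrite natrM invfM mulrA.
have /andP[h1 h2] := Hg _ M0; have /andP[f1 f2] := @lnfact_bound R _ M0.
have ly : ln M%:R <= ln y by rewrite ler_ln ?posrE // (lt_le_trans q0).
have lM := @ln_natr_ge0 R M.
have g1 := ler_norm g; have g2 := ler_norm (- g); rewrite normrN in g2.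
have M1 : 1 <= M%:R :> R by rewrite ler1n.
have yi : y * M%:R^-1 <= 2 by rewrite ler_pdivrMr //; lra.
have y0 : 0 < y by lra.
have k1 : y * (ln M%:R + g) <= y * harmonic M by rewrite ler_pM2l.
have k2 : y * harmonic M <= y * (ln M%:R + g) + 2.
  apply: (@le_trans _ _ (y * (ln M%:R + g + M%:R^-1))); first by rewrite ler_pM2l.
  by rewrite mulrDr; lra.
set e := y - M%:R; have e0 : 0 <= e by rewrite /e; lra.
have e1 : e <= 1 by rewrite /e; lra.
have ey : y = M%:R + e by rewrite /e; lra.
have t1 : 0 <= e * ln M%:R by rewrite mulr_ge0.
have t2 : e * ln M%:R <= ln M%:R by rewrite ler_piMl.
have t3 : e * g <= `|g| by apply: le_trans (ler_norm _) _; rewrite normrM ger0_norm // ler_piMl.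
have t4 : - `|g| <= e * g.
  by apply: le_trans (lerNnormlW (lexx _)); rewrite lerN2 normrM ger0_norm // ler_piMl.
have X : y * (ln M%:R + g) = M%:R * ln M%:R + e * ln M%:R + M%:R * g + e * g by rewrite ey; ring.
rewrite X in k1 k2.
rewrite mulrDl [g * _]mulrC mul1r ler_norml; apply/andP; split; lra.
Qed.

(** The identity is applied to the Chebyshev error [F k = psi (N %/ k) - N / k + c]. On the Moebius
    side the inner sums are only logarithmic, which makes the total linear in [N]. On the other side
    the terms [N / k] give [N ln N] once directly, at [k = 1], and once through Mertens. *)
Lemma selberg_nat : exists C : R, forall N : nat, (0 < N)%N ->
  `|psi N * ln N%:R + \sum_(1 <= k < N.+1) Lam k * psi (N %/ k)
    - 2 * N%:R * ln N%:R| <= C * N%:R.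
Proof.
have [c [K HK]] := tatuzawa_iseki_remainder.
pose K' := `|K|; have K'0 : 0 <= K' by exact: normr_ge0.
exists ((32 + 2 * K') * 2 + `|c| * 9 + 10) => N N0.
pose F k : R := psi (N %/ k) - N%:R / k%:R + c.
have p0 : (0 : R) < N%:R by rewrite ltr0n.
have N1 : 1 <= N%:R :> R by rewrite ler1n.
have B : `|F 1%N * ln N%:R + \sum_(1 <= k < N.+1) F k * Lam k| <=
   (32 + 2 * K') * 2 * N%:R.
  rewrite -tatuzawa_iseki //; apply: le_trans (ler_norm_sum _ _ _) _.
  apply: (@le_trans _ _ (\sum_(1 <= d < N.+1)
     (32 + 2 * K') * Num.sqrt N%:R * (Num.sqrt d%:R)^-1)).
    rewrite big_nat_cond [leRHS]big_nat_cond; apply: ler_sum => d /andP[/andP[d0 dN] _].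
    have q0 : (0 : R) < d%:R by rewrite ltr0n.
    have y1 : (1 : R) <= N%:R / d%:R by rewrite ler_pdivlMr // mul1r ler_nat.
    have -> : (32 + 2 * K') * Num.sqrt N%:R * (Num.sqrt d%:R)^-1 =
        (32 + 2 * K') * Num.sqrt (N%:R / d%:R).
      by rewrite -mulrA -sqrtrV ?ler0n // -sqrtrM ?ler0n.
    have := HK N d; rewrite d0 -ltnS dN => /(_ isT) Hd.
    have l0 := ln_ge0 y1.
    rewrite !normrM (ger0_norm l0).
    have m1 := @mobius_norm_le1 R d.
    apply: (@le_trans _ _ (ln (N%:R / d%:R) * (2 * ln (N%:R / d%:R) + K'))).
      rewrite -[leRHS]mul1r -[leLHS]mulrA; apply: ler_pM => //; first by rewrite mulr_ge0.
      apply: ler_wpM2l => //; apply: le_trans Hd _; rewrite lerD2l; exact: ler_norm.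
    have h1 := ln_le_2sqrt y1; have h2 := ln_sqr_le y1.
    set L := ln _ in h1 h2 *; set q := Num.sqrt _ in h1 h2 *.
    have := ler_wpM2l K'0 h1; rewrite expr2 in h2; nra.
  rewrite -mulr_sumr -!mulrA; apply: ler_wpM2l; first by lra.
  apply: le_trans (ler_wpM2l _ (sum_inv_sqrt N)) _; first exact: sqrtr_ge0.
  by rewrite mulrCA -expr2 sqr_sqrtr.
have E : F 1%N * ln N%:R + \sum_(1 <= k < N.+1) F k * Lam k =
   (psi N * ln N%:R + \sum_(1 <= k < N.+1) Lam k * psi (N %/ k) - 2 * N%:R * ln N%:R)
   + (c * ln N%:R + c * psi N - N%:R * (\sum_(1 <= k < N.+1) Lam k / k%:R - ln N%:R)).
  have -> : \sum_(1 <= k < N.+1) F k * Lam k =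
     \sum_(1 <= k < N.+1) Lam k * psi (N %/ k) -
     N%:R * \sum_(1 <= k < N.+1) Lam k / k%:R + c * psi N.
    have -> : psi N = \sum_(1 <= k < N.+1) Lam k by [].
    rewrite mulr_sumr [c * _]mulr_sumr -sumrB -big_split /=; apply: eq_bigr => k _.
    by rewrite /F; set i := k%:R^-1; ring.
  by rewrite /F divn1 divr1; ring.
rewrite E in B.
have m := @mertens R N N0; have ps := @psi_le R N; have ps0 := @psi_ge0 R N.
have lN : ln N%:R <= N%:R - 1 :> R by exact: ln_leB1.
have lN0 := @ln_natr_ge0 R N.
set X := psi N * _ + _ - _ in B *.
set Y := \sum_(1 <= k < N.+1) Lam k / k%:R - ln N%:R in m B.
have b1 : `|c * ln N%:R| <= `|c| * N%:R by rewrite normrM ler_wpM2l // ger0_norm //; lra.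
have b2 : `|c * psi N| <= `|c| * (8 * N%:R) by rewrite normrM ler_wpM2l // ger0_norm.
have b3 : `|N%:R * Y| <= N%:R * 10 by rewrite normrM ger0_norm // ler_wpM2l.
rewrite -[X](addrK (c * ln N%:R + c * psi N - N%:R * Y)).
apply: le_trans (ler_normB _ _) _.
apply: le_trans (lerD B (ler_normB _ _)) _.
have := ler_normD (c * ln N%:R) (c * psi N); lra.
Qed.

End Selberg.

(** * The symmetry formula in the variable [u = ln x], and its increments *)

Section LogScale.
Context {R : realType}.
Local Notation Lam := (@von_mangoldt R).
Local Notation psi := (@psi R).
Local Notation fl u := (Num.truncn (expR u)).
Implicit Types (u v : R) (k N : nat).

Definition psie (u : R) : R := psi (fl u).

Lemma psieE u : psie u = psi (fl u). Proof. by []. Qed.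

Lemma psie_homo : {homo psie : u v / u <= v >-> u <= v}.
Proof. by move=> u v uv; apply/psi_homo/le_truncn; rewrite ler_expR. Qed.

Lemma psie_ge0 u : 0 <= psie u. Proof. exact: psi_ge0. Qed.

Lemma psie_le u : psie u <= 8 * expR u.
Proof.
by apply: le_trans (psi_le _) _; rewrite ler_wpM2l // truncn_le expR_ge0.
Qed.

Lemma psie_lt0 u : u < 0 -> psie u = 0.
Proof.
move=> u0; rewrite /psie (_ : fl u = 0%N) ?psi0 //.
by apply/eqP; rewrite -leqn0 -ltnS truncn_lt_nat ?expR_ge0 // -expR0 ltr_expR.
Qed.

Lemma leq_floor_exp k u : (0 < k)%N -> (k <= fl u)%N = (ln k%:R <= u).
Proof.
move=> k0; rewrite truncn_ge_nat ?expR_ge0 //.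
by rewrite -[in RHS](expRK u) ler_ln // posrE ?expR_gt0 // ltr0n.
Qed.

Lemma psie_sub_ln u k : (0 < k)%N -> psie (u - ln k%:R) = psi (fl u %/ k).
Proof.
move=> k0; have p0 : (0 : R) < k%:R by rewrite ltr0n.
congr (psi _); rewrite expRB lnK ?posrE //; apply/eqP.
rewrite truncn_eq ?divr_ge0 ?expR_ge0 //.
rewrite ler_pdivlMr // ltr_pdivrMr // -!natrM; apply/andP; split.
  by rewrite -truncn_ge_nat ?expR_ge0 // leq_divM.
by rewrite -truncn_lt_nat ?expR_ge0 // ltn_ceil.
Qed.

Lemma floor_exp_gt0 u : 0 <= u -> (0 < fl u)%N.
Proof. by move=> u0; rewrite truncn_gt0 -expR0 ler_expR. Qed.

Lemma ln_floor_exp u : 0 <= u ->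
  [/\ ln (fl u)%:R <= u, (u - ln (fl u)%:R) * (fl u)%:R <= 1 &
      (fl u)%:R <= expR u <= (fl u)%:R + 1].
Proof.
move=> u0; have M0 := floor_exp_gt0 u0.
have p0 : (0 : R) < (fl u)%:R by rewrite ltr0n.
have h1 : (fl u)%:R <= expR u by rewrite truncn_le expR_ge0.
have h2 : expR u <= (fl u)%:R + 1 by rewrite natr1 ltW // truncnS_gt.
split.
- by rewrite -leq_floor_exp.
- rewrite -{1}(expRK u) -ln_div ?posrE ?expR_gt0 //.
  have := @ln_leB1 R (expR u / (fl u)%:R); rewrite divr_gt0 ?expR_gt0 // => /(_ isT) h.
  have : ln (expR u / (fl u)%:R) * (fl u)%:R <= (expR u / (fl u)%:R - 1) * (fl u)%:R.
    by rewrite ler_pM2r.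
  by rewrite mulrBl divfK ?gt_eqF //; lra.
- by rewrite h1.
Qed.

Lemma mertens_exp u : 0 <= u ->
  `|\sum_(1 <= k < (fl u).+1) Lam k / k%:R - u| <= 11.
Proof.
move=> u0; have := @mertens R _ (floor_exp_gt0 u0).
have [h1 h2 _] := ln_floor_exp u0.
have M1 : 1 <= (fl u)%:R :> R by rewrite ler1n floor_exp_gt0.
set S := \sum_(_ <= _ < _) _; set x := ln _ in h1 h2 *.
rewrite !ler_norml => /andP[a b]; apply/andP; split; nra.
Qed.

Definition selberg_fun u : R :=
  psie u * u + \sum_(1 <= k < (fl u).+1) Lam k * psie (u - ln k%:R).

Lemma selberg_exp : exists C : R, 0 <= C /\ forall u, 0 <= u ->
  `|selberg_fun u - 2 * expR u * u| <= C * expR u.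
Proof.
have [C HC] := @selberg_nat R; exists (`|C| + 14); split.
  by have := normr_ge0 C; lra.
move=> u u0; have M0 := floor_exp_gt0 u0.
have := HC _ M0; have [h1 h2 /andP[h3 h4]] := ln_floor_exp u0.
have -> : selberg_fun u = psi (fl u) * u +
    \sum_(1 <= k < (fl u).+1) Lam k * psi (fl u %/ k).
  congr (_ + _); apply: eq_big_nat => k /andP[k0 _].
  by rewrite psie_sub_ln.
have M1 : 1 <= (fl u)%:R :> R by rewrite ler1n.
have ps := @psi_le R (fl u); have ps0 := @psi_ge0 R (fl u).
have eu : u + 1 <= expR u by rewrite addrC expR_ge1Dx.
have c1 : C * (fl u)%:R <= `|C| * expR u.
  apply: le_trans (ler_wpM2r _ (ler_norm C)) _; first by rewrite ler0n.
  by rewrite ler_wpM2l.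
set S := \sum_(_ <= _ < _) _; set x := ln _ in h1 h2 *.
set M := (fl u)%:R in h2 h3 h4 M1 ps c1 *; set P := psi _ in ps ps0 *.
set e := expR u in h3 h4 eu c1 *.
have t1 : P * (u - x) <= 8 by nra.
have t2 : 0 <= P * (u - x) by nra.
have t3 : 2 * (e * u - M * x) <= 2 * e + 2 by nra.
have t4 : 0 <= 2 * (e * u - M * x) by nra.
have e1 : 1 <= e by lra.
rewrite !ler_norml => /andP[a b]; apply/andP; split; nra.
Qed.

Lemma selberg_increment : exists C : R, 0 <= C /\ forall u v,
  0 <= u -> u <= v -> v <= u + 1 ->
  `|(psie v - psie u) * u
    + \sum_(1 <= k < (fl v).+1) Lam k * (psie (v - ln k%:R) - psie (u - ln k%:R))
    - 2 * (expR v - expR u) * u| <= C * expR u.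
Proof.
have [C [C0 HC]] := selberg_exp.
exists (C * (expR 1 + 1) + 10 * expR 1); split.
  by have := expR_ge0 (1 : R); nra.
move=> u v u0 uv vu; have v0 : 0 <= v by lra.
have := HC _ u0; have := HC _ v0.
(* The range of summation is extended from [fl u] to [fl v], so that the two formulas can be
   subtracted termwise: for the added [k] the argument [u - ln k] is negative, where [psie]
   vanishes. *)
have -> : selberg_fun u =
    psie u * u + \sum_(1 <= k < (fl v).+1) Lam k * psie (u - ln k%:R).
  congr (_ + _); rewrite [RHS](big_cat_nat (n := (fl u).+1)) //=; last first.
    by rewrite ltnS le_truncn // ler_expR.
  rewrite [X in _ = _ + X]big_nat_cond [X in _ = _ + X]big1 ?addr0 //.
  move=> k /andP[/andP[k1 k2] _]; rewrite psie_lt0 ?mulr0 //.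
  by rewrite subr_lt0 ltNge -leq_floor_exp -?ltnNge //; apply: leq_trans k1.
rewrite /selberg_fun.
have -> : \sum_(1 <= k < (fl v).+1) Lam k * (psie (v - ln k%:R) - psie (u - ln k%:R)) =
  \sum_(1 <= k < (fl v).+1) Lam k * psie (v - ln k%:R) -
  \sum_(1 <= k < (fl v).+1) Lam k * psie (u - ln k%:R).
  by rewrite -sumrB; apply: eq_bigr => k _; rewrite mulrBr.
have pv := psie_le v; have pv0 := psie_ge0 v.
have ev : expR v <= expR 1 * expR u by rewrite -expRD ler_expR; lra.
have eu0 := expR_gt0 u; have e10 := expR_gt0 (1 : R); have ev0 := expR_gt0 v.
set S1 := \sum_(_ <= _ < _) _; set S2 := \sum_(_ <= _ < _) _.
have t1 : psie v * (v - u) <= 8 * (expR 1 * expR u) by nra.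
have t2 : 0 <= psie v * (v - u) by nra.
have t3 : 2 * expR v * (v - u) <= 2 * (expR 1 * expR u) by nra.
have t4 : 0 <= 2 * expR v * (v - u) by nra.
have t5 : C * expR v <= C * (expR 1 * expR u) by rewrite ler_wpM2l.
rewrite !ler_norml => /andP[a1 b1] /andP[a2 b2]; apply/andP; split; nra.
Qed.

Lemma sum_psie_increment_ge0 u v N : u <= v ->
  0 <= \sum_(1 <= k < N) Lam k * (psie (v - ln k%:R) - psie (u - ln k%:R)).
Proof.
move=> uv; apply: sumr_ge0 => k _; rewrite mulr_ge0 ?von_mangoldt_ge0 // subr_ge0.
by apply: psie_homo; rewrite lerD2r.
Qed.

Lemma psie_short_interval : exists C : R, 0 <= C /\ forall u v,
  0 <= u -> u <= v -> v <= u + 1 ->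
  (psie v - psie u) * u <= 2 * (expR v - expR u) * u + C * expR u.
Proof.
have [C [C0 HC]] := selberg_increment; exists C; split => // u v u0 uv vu.
have := HC u v u0 uv vu; have := sum_psie_increment_ge0 (fl v).+1 uv.
by set S := \sum_(_ <= _ < _) _; rewrite ler_norml => S0 /andP[_ h]; lra.
Qed.

End LogScale.

(** * Primes in short intervals *)

Section DensitySequences.
Context {R : realType}.
Implicit Types (a w : nat -> R) (A K eta : R) (I J N r : nat).

Lemma sum_initial_le (f g : nat -> R) (A : R) I0 J : 0 <= A ->
  (forall i, f i <= g i + A) -> (forall i, (I0 <= i)%N -> f i <= g i) ->
  \sum_(0 <= i < J) f i <= \sum_(0 <= i < J) g i + A * I0%:R.
Proof.
move=> A0 fA fg.
have -> : A * I0%:R = \sum_(0 <= i < I0) A by rewrite sumr_const_nat subn0 mulr_natr.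
have step n : \sum_(0 <= i < n) f i <= \sum_(0 <= i < n) g i + \sum_(0 <= i < minn n I0) A.
  elim: n => [|n IH]; first by rewrite min0n !big_geq // addr0.
  rewrite !big_nat_recr //=; have [nI|nI] := ltnP n I0.
    have -> : minn n.+1 I0 = (minn n I0).+1 by lia.
    rewrite big_nat_recr //=; have := fA n; lra.
  have -> : minn n.+1 I0 = minn n I0 by lia.
  have := fg n nI; lra.
apply: le_trans (step J) _; rewrite lerD2l !sumr_const_nat !subn0.
by apply: ler_wpMn2l; rewrite ?geq_minr.
Qed.

(* AM-GM bounds the correlation by the mean of [a ^ 2 / 2 + w ^ 2 / 2], where
   [a ^ 2 <= 2 a] has mean at most [2]; so [w ^ 2] has mean almost [2], that of
   [2 w]. *)
Lemma autocorrelation_variance a w A K eta I0 : 0 <= A -> 0 <= K -> 0 < eta <= 1 ->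
  (forall i, 0 <= a i <= A) -> (forall i, 0 <= w i <= A) ->
  (forall i, (I0 <= i)%N -> a i <= 2 + eta) ->
  (forall n, \sum_(0 <= i < n) a i <= (1 + eta) * n%:R + K) ->
  (forall n, \sum_(0 <= i < n) w i <= (1 + eta) * n%:R + K) ->
  exists K', forall J,
    (2 - 2 * eta) * J%:R - K <=
      \sum_(0 <= i < J) a i * w (J - i)%N
      + eta * \sum_(0 <= i < J) a i * a (J - i.+1)%N ->
    \sum_(0 <= j < J) w j * (2 - w j) <= 25 * eta * J%:R + K'.
Proof.
move=> A0 K0 /andP[e0 e1] ha hw ha2 sa sw.
pose K1 := 3 * K + A ^+ 2 * I0%:R.
have sqa n : \sum_(0 <= i < n) a i ^+ 2 <= (2 + 5 * eta) * n%:R + K1.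
  have A2 : 0 <= A ^+ 2 by exact: sqr_ge0.
  have := @sum_initial_le (fun i => a i ^+ 2) (fun i => (2 + eta) * a i) (A ^+ 2) I0 n A2.
  have h1 i : a i ^+ 2 <= (2 + eta) * a i + A ^+ 2.
    have /andP[a0 a1] := ha i; rewrite !expr2; nra.
  have h2 i : (I0 <= i)%N -> a i ^+ 2 <= (2 + eta) * a i.
    by move=> /ha2 ai; have /andP[a0 a1] := ha i; rewrite expr2 ler_wpM2r.
  move=> /(_ h1 h2); rewrite -mulr_sumr; have := sa n; rewrite /K1.
  have n0 : 0 <= n%:R :> R by rewrite ler0n.
  move: n0; set x := n%:R; set S := \sum_(_ <= _ < _) a _; set T := \sum_(_ <= _ < _) _.
  move=> x0 h h'; apply: le_trans h' _; rewrite addrA lerD2r.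
  have : (2 + eta) * S <= (2 + eta) * ((1 + eta) * x + K) by rewrite ler_wpM2l //; lra.
  have : eta * (eta * x) <= eta * x by apply: (ler_wpM2l (ltW e0)); rewrite ler_piMl.
  have : eta * K <= K by rewrite ler_piMl.
  have : 0 <= eta * x by rewrite mulr_ge0 // ltW.
  lra.
pose K2 := 2 * K + 2 * K + K1 + 2 * K1 + A ^+ 2.
exists K2 => J h5.
have J0 : 0 <= J%:R :> R by rewrite ler0n.
have aa : \sum_(0 <= i < J) a i * a (J - i.+1)%N <= \sum_(0 <= i < J) a i ^+ 2.
  have rev : \sum_(0 <= i < J) a (J - i.+1)%N ^+ 2 = \sum_(0 <= i < J) a i ^+ 2.
    by rewrite [RHS]big_nat_rev.
  have : \sum_(0 <= i < J) a i * a (J - i.+1)%N <=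
     \sum_(0 <= i < J) (2^-1 * a i ^+ 2 + 2^-1 * a (J - i.+1)%N ^+ 2).
    apply: ler_sum => i _; have := sqr_ge0 (a i - a (J - i.+1)%N); rewrite !expr2; lra.
  by rewrite big_split /= -!mulr_sumr rev; lra.
have aw : \sum_(0 <= i < J) a i * w (J - i)%N <=
   2^-1 * \sum_(0 <= i < J) a i ^+ 2 + 2^-1 * (\sum_(0 <= i < J) w i ^+ 2 + A ^+ 2).
  have rev : \sum_(0 <= i < J) w (J - i)%N ^+ 2 <= \sum_(0 <= i < J) w i ^+ 2 + A ^+ 2.
    rewrite big_nat_rev /=.
    rewrite (eq_big_nat _ _ (F2 := fun i => w i.+1 ^+ 2)) => [|i /andP[_ iJ]]; last first.
      by congr (w _ ^+ 2); lia.
    have h : \sum_(0 <= i < J.+1) w i ^+ 2 = w 0%N ^+ 2 + \sum_(0 <= i < J) w i.+1 ^+ 2.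
      by rewrite big_nat_recl.
    have h' : \sum_(0 <= i < J.+1) w i ^+ 2 = \sum_(0 <= i < J) w i ^+ 2 + w J ^+ 2.
      by rewrite big_nat_recr.
    have wJ : w J ^+ 2 <= A ^+ 2.
      by have /andP[w0 w1] := hw J; rewrite lerXn2r // nnegrE.
    have := sqr_ge0 (w 0%N); have := etrans (esym h') h; lra.
  have : \sum_(0 <= i < J) a i * w (J - i)%N <=
     \sum_(0 <= i < J) (2^-1 * a i ^+ 2 + 2^-1 * w (J - i)%N ^+ 2).
    apply: ler_sum => i _; have := sqr_ge0 (a i - w (J - i)%N); rewrite !expr2; lra.
  rewrite big_split /= -!mulr_sumr; lra.
have -> : \sum_(0 <= j < J) w j * (2 - w j) =
   2 * \sum_(0 <= j < J) w j - \sum_(0 <= j < J) w j ^+ 2.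
  by rewrite mulr_sumr -sumrB; apply: eq_bigr => j _; rewrite expr2; ring.
have sq := sqa J; have swJ := sw J.
have eaa : eta * \sum_(0 <= i < J) a i * a (J - i.+1)%N <= 7 * eta * J%:R + K1.
  have K10 : 0 <= K1 by rewrite /K1 addr_ge0 ?mulr_ge0 ?sqr_ge0.
  apply: le_trans (ler_wpM2l (ltW e0) (le_trans aa sq)) _.
  have : eta * (eta * J%:R) <= eta * J%:R by apply: (ler_wpM2l (ltW e0)); rewrite ler_piMl.
  have : eta * K1 <= K1 by rewrite ler_piMl.
  have : 0 <= eta * J%:R by rewrite mulr_ge0 // ltW.
  lra.
rewrite /K2; lra.
Qed.

(** Discrete intermediate values: steps are at most 1/10, so [w] cannot jump across [[6/10, 15/10]];
    avoiding it, [w] would stay on one side and violate the mean bounds 7/10 and 14/10. From a visit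
    at [j0], [w] moves by at most 1/10 during [r] steps, stays in [[5/10, 16/10]], and there
    [w (2 - w) >= 1/2]. Elsewhere [w <= 2 + eta] gives at least [- 3 eta]. The block has length
    [N + r] because the visit may occur at the end of the first [N] indices. *)
Lemma block_variance w eta (i N r : nat) : (0 < N)%N -> (0 < r)%N -> 0 < eta <= 1 ->
  (forall j, (i <= j)%N -> 0 <= w j <= 2 + eta) ->
  (forall j, (i <= j)%N -> `|w j.+1 - w j| * r%:R <= 10^-1) ->
  7 / 10 * N%:R <= \sum_(i <= j < i + N) w j <= 14 / 10 * N%:R ->
  r%:R / 2 - 3 * eta * (N + r)%:R <= \sum_(i <= j < i + (N + r)) w j * (2 - w j).
Proof.
move=> N0 r0 /andP[e0 e1] hw st /andP[s1 s2].
have r1 : 1 <= r%:R :> R by rewrite ler1n.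
have st' j : (i <= j)%N -> `|w j.+1 - w j| <= 10^-1.
  by move=> /st; apply: le_trans; rewrite ler_peMr.
have [j0 /andP[ij jN] /andP[w1 w2]] : exists2 j, (i <= j < i + N)%N & 6 / 10 <= w j <= 15 / 10.
  have [//|no] := pselect (exists2 j, (i <= j < i + N)%N & 6 / 10 <= w j <= 15 / 10).
  have alt j : (i <= j < i + N)%N -> w j < 6 / 10 \/ 15 / 10 < w j.
    move=> hj; have [|h1] := ltP (w j) (6 / 10); first by left.
    by have [|h2] := ltP (15 / 10) (w j); [right|case: no; exists j => //; rewrite h1].
  have Ni : \sum_(i <= j < i + N) (1 : R) = N%:R.
    by rewrite sumr_const_nat addKn.
  have p0 : (0 : R) < N%:R by rewrite ltr0n.
  have iN : (i <= i < i + N)%N by rewrite leqnn -[X in (X < _)%N]addn0 ltn_add2l.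
  have [wi|wi] := alt i iN.
    have all_lo k : (k < N)%N -> w (i + k)%N < 6 / 10.
      elim: k => [|k IH] kN; first by rewrite addn0.
      have := IH (ltnW kN); have := st' (i + k)%N (leq_addr _ _).
      have [|//|] := alt (i + k.+1)%N; first by rewrite leq_addr ltn_add2l.
      by rewrite addnS ler_norml; lra.
    suff : \sum_(i <= j < i + N) w j <= \sum_(i <= j < i + N) (6 / 10).
      rewrite sumr_const_nat addKn -mulr_natr; lra.
    rewrite big_nat_cond [leRHS]big_nat_cond; apply: ler_sum => j /andP[/andP[ij jN] _].
    by rewrite -(subnKC ij) ltW // all_lo // ltn_subLR.
  have all_hi k : (k < N)%N -> 15 / 10 < w (i + k)%N.
    elim: k => [|k IH] kN; first by rewrite addn0.
    have := IH (ltnW kN); have := st' (i + k)%N (leq_addr _ _).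
    have [||//] := alt (i + k.+1)%N; first by rewrite leq_addr ltn_add2l.
    by rewrite addnS ler_norml; lra.
  suff : \sum_(i <= j < i + N) (15 / 10) <= \sum_(i <= j < i + N) w j.
    rewrite sumr_const_nat addKn -mulr_natr; lra.
  rewrite big_nat_cond [leRHS]big_nat_cond; apply: ler_sum => j /andP[/andP[ij jN] _].
  by rewrite -(subnKC ij) ltW // all_hi // ltn_subLR.
have near k : (k <= r)%N -> `|w (j0 + k)%N - w j0| * r%:R <= k%:R / 10.
  elim: k => [|k IH] kr; first by rewrite addn0 subrr normr0 !mul0r.
  have := IH (ltnW kr); have := st (j0 + k)%N (leq_trans ij (leq_addr _ _)).
  have : `|w (j0 + k.+1)%N - w j0| <= `|w (j0 + k).+1 - w (j0 + k)%N| + `|w (j0 + k)%N - w j0|.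
    by rewrite addnS; apply: le_trans (ler_normD _ _); rewrite addrA subrK.
  rewrite -(ler_pM2r (lt_le_trans ltr01 r1)) -natr1; lra.
have mid k : (k < r)%N -> 1 / 2 <= w (j0 + k)%N * (2 - w (j0 + k)%N).
  move=> kr; have := near k (ltnW kr).
  have kr' : k%:R <= r%:R :> R by rewrite ler_nat ltnW.
  have rp : (0 : R) < r%:R by rewrite ltr0n.
  rewrite -ler_pdivlMr // => h; have {}h : `|w (j0 + k)%N - w j0| <= 10^-1.
    apply: le_trans h _; rewrite ler_pdivrMr //; lra.
  move: h; rewrite ler_norml => /andP[h1 h2].
  have : (w (j0 + k)%N - 1 / 2) * (16 / 10 - w (j0 + k)%N) >= 0 by apply: mulr_ge0; lra.
  have : w (j0 + k)%N >= 1 / 2 by lra.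
  have : w (j0 + k)%N <= 16 / 10 by lra.
  nra.
have lo j : (i <= j)%N -> - (3 * eta) <= w j * (2 - w j).
  move=> /hw /andP[x0 x1]; nra.
have lo_sum x y : (i <= x)%N -> - (3 * eta) * (y - x)%:R <= \sum_(x <= j < y) w j * (2 - w j).
  move=> ix; rewrite mulr_natr -sumr_const_nat big_nat_cond [leRHS]big_nat_cond.
  by apply: ler_sum => j /andP[/andP[xj _] _]; apply: lo; exact: leq_trans xj.
rewrite (big_cat_nat (n := j0)) //=; last by lia.
rewrite [X in _ <= _ + X](big_cat_nat (n := (j0 + r)%N)) /=; [|by lia|by lia].
have h1 := lo_sum i j0 (leqnn _).
have h2 := lo_sum (j0 + r)%N (i + (N + r))%N (leq_trans ij (leq_addr _ _)).
have h3 : r%:R / 2 <= \sum_(j0 <= j < j0 + r) w j * (2 - w j).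
  have -> : r%:R / 2 = \sum_(j0 <= j < j0 + r) (1 / 2) :> R.
    by rewrite sumr_const_nat addKn mulr_natl mul1r.
  rewrite big_nat_cond [leRHS]big_nat_cond; apply: ler_sum => j /andP[/andP[xj jy] _].
  by rewrite -(subnKC xj) mid // ltn_subLR.
have h4 : (j0 - i)%:R + (i + (N + r) - (j0 + r))%:R <= (N + r)%:R :> R.
  by rewrite -natrD ler_nat; clear -ij jN; lia.
have h5 := ler_wpM2l (ltW e0) h4.
lra.
Qed.

(** The indices from [I0] to [J] are cut into blocks of length [N + r], each contributing its share;
    the initial stretch and the incomplete last block cost a constant. *)
Lemma variance_lower_bound w A eta I0 N r : (0 < N)%N -> (0 < r)%N -> 0 < eta <= 1 ->
  (forall j, 0 <= w j <= A) ->
  (forall j, (I0 <= j)%N -> w j <= 2 + eta) ->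
  (forall j, (I0 <= j)%N -> `|w j.+1 - w j| * r%:R <= 10^-1) ->
  (forall i, (I0 <= i)%N ->
     7 / 10 * N%:R <= \sum_(i <= j < i + N) w j <= 14 / 10 * N%:R) ->
  exists K, forall J,
    (r%:R / 2 / (N + r)%:R - 3 * eta) * J%:R - K <= \sum_(0 <= j < J) w j * (2 - w j).
Proof.
move=> N0 r0 he hA hw st bl; have /andP[e0 e1] := he.
have Nr0 : (0 < N + r)%N by rewrite addn_gt0 N0.
pose L := (N + r)%N; pose c := r%:R / 2 / L%:R - 3 * eta.
have L0 : (0 : R) < L%:R by rewrite ltr0n.
have blocks M : (c * L%:R) * M%:R <= \sum_(I0 <= j < I0 + M * L) w j * (2 - w j).
  elim: M => [|M IH]; first by rewrite mulr0 mul0n addn0 big_geq.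
  rewrite (big_cat_nat (n := (I0 + M * L)%N)) /=; [|by lia|by lia].
  have := @block_variance w eta (I0 + M * L) N r N0 r0 he.
  have -> : (I0 + M.+1 * L = I0 + M * L + (N + r))%N by rewrite /L; lia.
  have hj j : (I0 + M * L <= j)%N -> (I0 <= j)%N by apply: leq_trans; rewrite leq_addr.
  have h1 j : (I0 + M * L <= j)%N -> 0 <= w j <= 2 + eta.
    by move=> /hj/hw ->; have /andP[->] := hA j.
  have h2 j : (I0 + M * L <= j)%N -> `|w j.+1 - w j| * r%:R <= 10^-1.
    by move=> /hj/st.
  move=> /(_ h1 h2 (bl _ (leq_addr _ _))).
  have cL : c * L%:R = r%:R / 2 - 3 * eta * (N + r)%:R.
    by rewrite /c mulrBl divfK ?gt_eqF.
  rewrite cL -natr1 in IH *; lra.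
have neg j : - A ^+ 2 <= w j * (2 - w j).
  have /andP[x0 x1] := hA j; rewrite expr2; nra.
have neg_sum x y z : (y - x <= z)%N -> - A ^+ 2 * z%:R <= \sum_(x <= j < y) w j * (2 - w j).
  move=> yz; apply: (@le_trans _ _ (- A ^+ 2 * (y - x)%:R)).
    by rewrite !mulNr lerN2 ler_wpM2l ?sqr_ge0 // ler_nat.
  by rewrite mulr_natr -sumr_const_nat; apply: ler_sum.
(* The sign of [c] is not known here, whence its absolute value in the constant. *)
exists (A ^+ 2 * I0%:R + A ^+ 2 * L%:R + `|c| * (I0%:R + L%:R)) => J.
rewrite -/L -/c.
have [JI|IJ] := leqP J I0.
  have := neg_sum 0%N J I0; rewrite subn0 => /(_ JI).
  have : c * J%:R <= `|c| * I0%:R.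
    apply: le_trans (ler_wpM2r _ (ler_norm c)) _; rewrite ?ler0n // ler_wpM2l //.
    by rewrite ler_nat.
  have : 0 <= A ^+ 2 * L%:R by rewrite mulr_ge0 ?sqr_ge0.
  have : 0 <= `|c| * L%:R by rewrite mulr_ge0.
  lra.
pose M := ((J - I0) %/ L)%N; pose q := ((J - I0) %% L)%N.
have EJ : J = (I0 + M * L + q)%N by rewrite /M /q -addnA -divn_eq subnKC // ltnW.
have qL : (q < L)%N by rewrite ltn_mod.
rewrite (big_cat_nat (n := I0)) //=; last by lia.
rewrite [X in _ <= _ + X](big_cat_nat (n := (I0 + M * L)%N)) /=; [|by lia|by lia].
have n1 := neg_sum 0%N I0 I0; rewrite subn0 leqnn in n1; have {}n1 := n1 isT.
have n2 : - A ^+ 2 * L%:R <= \sum_(I0 + M * L <= j < J) w j * (2 - w j).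
  by apply: neg_sum; lia.
have := blocks M.
have EJR : J%:R = I0%:R + M%:R * L%:R + q%:R :> R by rewrite {1}EJ 2!natrD natrM.
have : c * (I0%:R + q%:R) <= `|c| * (I0%:R + L%:R).
  apply: le_trans (ler_wpM2r _ (ler_norm c)) _; first by rewrite addr_ge0.
  by rewrite ler_wpM2l // lerD2l ler_nat ltnW.
rewrite EJR; lra.
Qed.

End DensitySequences.

(** * Prime densities on a logarithmic grid *)

Section Grid.
Context {R : realType}.
Local Notation Lam := (@von_mangoldt R).
Local Notation psie := (@psie R).
Local Notation fl u := (Num.truncn (expR u)).

Lemma expR_le_1D2 (l : R) : 0 <= l <= 1 / 2 -> expR l <= 1 + 2 * l.
Proof.
move=> /andP[l0 l1]; have := expR_ge1Dx (- l); rewrite expRN => h.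
have e0 := expR_gt0 l.
have : (1 - l) * expR l <= 1 by rewrite -ler_pdivlMr // div1r.
nra.
Qed.

(* The von Mangoldt mass of [(e^(jl), e^((j+B)l)]] divided by its length. *)
Definition grid_density (l : R) (B j : nat) : R :=
  (psie ((j + B)%:R * l) - psie (j%:R * l)) /
  (expR (j%:R * l) * (expR (B%:R * l) - 1)).

Lemma expR_gridD (l : R) (j B : nat) :
  expR ((j + B)%:R * l) = expR (j%:R * l) * expR (B%:R * l).
Proof. by rewrite natrD mulrDl expRD. Qed.

Section FixedGrid.
Context (l : R) (l_gt0 : 0 < l).
Local Notation dens := (grid_density l).

Lemma grid_factor_gt0 (B : nat) : (0 < B)%N -> 0 < expR (B%:R * l) - 1.
Proof.
by move=> B0; rewrite subr_gt0 expR_gt1 mulr_gt0 ?ltr0n.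
Qed.

Lemma le_grid (i j : nat) : (i <= j)%N -> i%:R * l <= j%:R * l.
Proof. by move=> ij; rewrite ler_pM2r // ler_nat. Qed.

Lemma grid_densityE (B j : nat) : (0 < B)%N ->
  psie ((j + B)%:R * l) - psie (j%:R * l) =
  expR (j%:R * l) * (expR (B%:R * l) - 1) * dens B j.
Proof.
move=> B0; rewrite /grid_density [RHS]mulrC divfK // mulf_neq0 // gt_eqF ?expR_gt0 //.
exact: grid_factor_gt0.
Qed.

Lemma grid_density_ge0 (B j : nat) : (0 < B)%N -> 0 <= dens B j.
Proof.
move=> B0; rewrite /grid_density divr_ge0 //.
  by rewrite subr_ge0; apply/psie_homo/le_grid/leq_addr.
by rewrite mulr_ge0 ?expR_ge0 // ltW // grid_factor_gt0.
Qed.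

Lemma grid_density_bounded (B j : nat) : (0 < B)%N ->
  dens B j <= 8 * expR (B%:R * l) / (expR (B%:R * l) - 1).
Proof.
move=> B0; have g0 := grid_factor_gt0 B0; have e0 := expR_gt0 (j%:R * l).
rewrite /grid_density ler_pdivrMr ?mulr_gt0 //.
have -> : 8 * expR (B%:R * l) / (expR (B%:R * l) - 1) *
    (expR (j%:R * l) * (expR (B%:R * l) - 1)) = 8 * expR ((j + B)%:R * l).
  by rewrite expR_gridD; field; rewrite gt_eqF.
have := @psie_le R ((j + B)%:R * l); have := @psie_ge0 R (j%:R * l); lra.
Qed.

Lemma grid_cell_sum (i n : nat) : (i <= n)%N ->
  psie (n%:R * l) - psie (i%:R * l) =
  \sum_((fl (i%:R * l)).+1 <= k < (fl (n%:R * l)).+1) Lam k.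
Proof.
move=> lin; rewrite !psieE /psi.
rewrite [X in X - _](big_cat_nat (n := (fl (i%:R * l)).+1)) //=; last first.
  by rewrite ltnS le_truncn // ler_expR le_grid.
by rewrite addrAC subrr add0r.
Qed.

Lemma sum_grid_cells (f : nat -> R) (i n : nat) : (i <= n)%N ->
  \sum_((fl (i%:R * l)).+1 <= k < (fl (n%:R * l)).+1) f k =
  \sum_(i <= j < n) \sum_((fl (j%:R * l)).+1 <= k < (fl (j.+1%:R * l)).+1) f k.
Proof.
move=> /subnK <-; elim: (n - i)%N => [|m IH]; first by rewrite add0n !big_geq.
rewrite addSn (big_nat_recr (m + i)) ?leq_addl //= -IH.
by rewrite -big_cat_nat //= ltnS le_truncn // ler_expR le_grid // ?leq_addl.
Qed.

(** The block starting at [j + 1] is the block starting at [j] with its first cell removed and one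
    cell appended. Since [expR l - 1] is of order [l], block densities vary slowly, whatever the
    cell densities do. *)
Lemma grid_density_step (B j : nat) : (0 < B)%N ->
  expR l * (expR (B%:R * l) - 1) * dens B j.+1 =
  (expR (B%:R * l) - 1) * dens B j
  + (expR l - 1) * (expR (B%:R * l) * dens 1 (j + B) - dens 1 j).
Proof.
move=> B0; apply: (mulfI (lt0r_neq0 (expR_gt0 (j%:R * l)))).
have := grid_densityE j.+1 B0; have := grid_densityE j B0.
have := grid_densityE (j + B) (ltn0Sn 0); have := grid_densityE j (ltn0Sn 0).
rewrite !addn1 mul1r addSn.
have -> : j.+1%:R * l = (j + 1)%:R * l by rewrite addn1.
rewrite !expR_gridD mul1r.
set e := expR (j%:R * l); set b := expR (B%:R * l); set q := expR l.
move=> h1 h2 h3 h4.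
have -> : e * (q * (b - 1) * dens B j.+1) = e * q * (b - 1) * dens B j.+1 by ring.
rewrite -h4 mulrDr mulrA -h3.
have -> : e * ((q - 1) * (b * dens 1 (j + B)%N - dens 1 j)) =
   e * b * (q - 1) * dens 1 (j + B)%N - e * (q - 1) * dens 1 j by ring.
by rewrite -h2 -h1 addn1; ring.
Qed.

(** A block density is a weighted average of cell densities with weights independent of [j], so that
    mean values pass from cells to blocks. *)
Lemma grid_density_avg (B j : nat) : (0 < B)%N ->
  (expR (B%:R * l) - 1) * dens B j =
  \sum_(0 <= b < B) expR (b%:R * l) * ((expR l - 1) * dens 1 (j + b)%N).
Proof.
move=> B0; apply: (mulfI (lt0r_neq0 (expR_gt0 (j%:R * l)))).
rewrite mulrA -grid_densityE //.
have T n : psie ((j + n)%:R * l) - psie (j%:R * l) =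
    \sum_(0 <= b < n) (psie ((j + b).+1%:R * l) - psie ((j + b)%:R * l)).
  elim: n => [|n IH]; first by rewrite addn0 subrr big_geq.
  by rewrite big_nat_recr //= -IH addnS; ring.
rewrite T mulr_sumr; apply: eq_bigr => b _.
have := grid_densityE (j + b) (ltn0Sn 0); rewrite addn1 mul1r expR_gridD => ->.
by rewrite !mulrA.
Qed.

Lemma sum_grid_weights (B : nat) :
  \sum_(0 <= b < B) expR (b%:R * l) * (expR l - 1) = expR (B%:R * l) - 1.
Proof.
elim: B => [|B IH]; first by rewrite big_geq // mul0r expR0 subrr.
rewrite big_nat_recr //= IH -addn1 expR_gridD mul1r; ring.
Qed.

(** Mertens at both ends gives the sum of [Lam k / k] over [n] cells as [n l] with error
    [2 * 11 = 22], uniformly in [i]. Within one cell [1 / k] is constant up to a factor [expR l],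
    which turns that sum into cell densities. *)
Lemma grid_cell_mean (i n : nat) :
  n%:R * l - 22 <= (expR l - 1) * \sum_(i <= j < i + n) dens 1 j
    <= expR l * (n%:R * l + 22).
Proof.
pose M (u : R) := \sum_(1 <= k < (fl u).+1) Lam k / k%:R.
have cells : M ((i + n)%:R * l) - M (i%:R * l) =
   \sum_(i <= j < i + n) \sum_((fl (j%:R * l)).+1 <= k < (fl (j.+1%:R * l)).+1) Lam k / k%:R.
  rewrite -sum_grid_cells ?leq_addr // /M.
  rewrite [X in X - _](big_cat_nat (n := (fl (i%:R * l)).+1)) //=; last first.
    by rewrite ltnS le_truncn // ler_expR le_grid // leq_addr.
  by rewrite addrAC subrr add0r.
have Mb : n%:R * l - 22 <= M ((i + n)%:R * l) - M (i%:R * l) <= n%:R * l + 22.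
  have u0 k : 0 <= k%:R * l by rewrite mulr_ge0 ?ler0n // ltW.
  have := mertens_exp (u0 (i + n)%N); have := mertens_exp (u0 i).
  rewrite -!/(M _) natrD mulrDl !ler_norml => /andP[a1 a2] /andP[a3 a4].
  by apply/andP; split; lra.
have cell j : let S := \sum_((fl (j%:R * l)).+1 <= k < (fl (j.+1%:R * l)).+1) Lam k / k%:R in
   S <= (expR l - 1) * dens 1 j <= expR l * S.
  move=> S.
  have E : expR (j%:R * l) * ((expR l - 1) * dens 1 j) =
     \sum_((fl (j%:R * l)).+1 <= k < (fl (j.+1%:R * l)).+1) Lam k.
    rewrite -(grid_cell_sum (leqnSn j)).
    by have := grid_densityE j (ltn0Sn 0); rewrite addn1 mul1r mulrA => ->.
  have e0 := expR_gt0 (j%:R * l).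
  have kb k : ((fl (j%:R * l)).+1 <= k < (fl (j.+1%:R * l)).+1)%N ->
     [/\ (0 : R) < k%:R, expR (j%:R * l) <= k%:R & k%:R <= expR (j%:R * l) * expR l].
    move=> /andP[k1 k2]; have k0 : (0 < k)%N by apply: leq_trans k1.
    split; first by rewrite ltr0n.
      by rewrite ltW // -truncn_lt_nat ?expR_ge0.
    have -> : expR (j%:R * l) * expR l = expR (j.+1%:R * l).
      by rewrite -addn1 expR_gridD mul1r.
    by rewrite -truncn_ge_nat ?expR_ge0.
  rewrite -(ler_pM2l e0) -[X in _ && X](ler_pM2l e0) E; apply/andP; split.
    rewrite /S mulr_sumr big_nat_cond [leRHS]big_nat_cond.
    apply: ler_sum => k /andP[/kb[k0 k1 k2] _].
    rewrite mulrCA; apply: ler_piMr; first exact: von_mangoldt_ge0.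
    by rewrite ler_pdivrMr // mul1r.
  rewrite /S !mulr_sumr big_nat_cond [leRHS]big_nat_cond.
  apply: ler_sum => k /andP[/kb[k0 k1 k2] _].
  rewrite [leRHS]mulrA [leRHS]mulrCA; apply: ler_peMr; first exact: von_mangoldt_ge0.
  by rewrite ler_pdivlMr // mul1r.
have /andP[b1 b2] := Mb; rewrite cells in b1 b2.
rewrite mulr_sumr; apply/andP; split.
  by apply: le_trans b1 _; apply: ler_sum => j _; have /andP[] := cell j.
apply: (@le_trans _ _ (expR l * \sum_(i <= j < i + n)
    \sum_((fl (j%:R * l)).+1 <= k < (fl (j.+1%:R * l)).+1) Lam k / k%:R)).
  by rewrite mulr_sumr; apply: ler_sum => j _; have /andP[] := cell j.
by rewrite ler_pM2l ?expR_gt0.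
Qed.

Lemma grid_mean (B i n : nat) : (0 < B)%N ->
  n%:R * l - 22 <= (expR l - 1) * \sum_(i <= j < i + n) dens B j
    <= expR l * (n%:R * l + 22).
Proof.
move=> B0; have g0 := grid_factor_gt0 B0.
have g1 : 0 < expR l - 1 by have := grid_factor_gt0 (ltn0Sn 0); rewrite mul1r.
have E : (expR (B%:R * l) - 1) * ((expR l - 1) * \sum_(i <= j < i + n) dens B j) =
  \sum_(0 <= b < B) expR (b%:R * l) * (expR l - 1) *
    ((expR l - 1) * \sum_(i + b <= j < i + b + n) dens 1 j).
  rewrite mulrCA mulr_sumr (eq_bigr _ (fun j _ => grid_density_avg j B0)).
  rewrite exchange_big_nat /= mulr_sumr; apply: eq_bigr => b _.
  have -> : (i + b + n = i + n + b)%N by lia.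
  rewrite big_addn addnK !mulr_sumr; apply: eq_big_nat => j _.
  by rewrite mulrCA !mulrA.
rewrite -(ler_pM2l g0) -[X in _ && X](ler_pM2l g0) E -sum_grid_weights !mulr_suml.
have w0 b : 0 <= expR (b%:R * l) * (expR l - 1) by rewrite mulr_ge0 ?expR_ge0 // ltW.
by apply/andP; split; apply: ler_sum => b _; apply: ler_wpM2l => //;
  have /andP[] := grid_cell_mean (i + b) n.
Qed.

End FixedGrid.

Lemma grid_density_le : exists C : R, 0 <= C /\ forall l B j,
  0 < l -> (0 < B)%N -> B%:R * l <= 1 -> (0 < j)%N ->
  grid_density l B j <= 2 + C / (j%:R * l * (expR (B%:R * l) - 1)).
Proof.
have [C [C0 HC]] := @psie_short_interval R; exists C; split => // l B j l0 B0 Bl j0.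
have g0 := grid_factor_gt0 l0 B0; have e0 := expR_gt0 (j%:R * l).
have u0 : 0 < j%:R * l by rewrite mulr_gt0 // ltr0n.
have := HC (j%:R * l) ((j + B)%:R * l) (ltW u0).
rewrite le_grid ?leq_addr // natrD mulrDl lerD2l => /(_ isT Bl).
rewrite -mulrDl -natrD grid_densityE // expR_gridD.
set e := expR (j%:R * l) in e0 *; set b := expR (B%:R * l) in g0 *.
set u := j%:R * l in u0 *; set d := grid_density _ _ _.
move=> h; rewrite -lerBlDl (ler_pdivlMr _ _ (mulr_gt0 u0 g0)) -(ler_pM2l e0); lra.
Qed.

(** The hypothesis makes the first term of the increment formula small, so the sum over [k] must
    nearly supply the whole main term. For [k] in cell [i], [ln k] lies between [i l] and
    [(i + 1) l], so the interval from [u - ln k] to [v - ln k] is covered by the block at [J - i]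
    and the single cell at [J - i - 1]; that cell is the price of discretization and is of relative
    size [l]. The last [B] cells contribute only a constant multiple of [expR u], by Chebyshev. *)
Lemma grid_selberg : exists C : R, 0 <= C /\ forall l B J delta,
  0 < l -> (0 < B)%N -> B%:R * l <= 1 -> 
  psie ((J + B)%:R * l) - psie (J%:R * l) <= delta * expR (J%:R * l) ->
  (2 * (expR (B%:R * l) - 1) - delta) * l * J%:R - C <=
  \sum_(0 <= i < J) (expR l - 1) * grid_density l 1 i *
    ((expR (B%:R * l) - 1) * grid_density l B (J - i)%N +
     (expR l - 1) * grid_density l 1 (J - i.+1)%N).
Proof.
have [C [C0 HC]] := @selberg_increment R; exists (C + 64 * expR 2); split.
  by rewrite addr_ge0 // mulr_ge0 // expR_ge0.
move=> l B J delta l0 B0 Bl gap.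
set u := J%:R * l; set v := (J + B)%:R * l.
have u0 : 0 <= u by rewrite mulr_ge0 ?ler0n // ltW.
have uv : u <= v by rewrite le_grid // leq_addr.
have vu : v = u + B%:R * l by rewrite /v natrD mulrDl.
have := HC u v u0 uv; rewrite {1}vu lerD2l => /(_ Bl).
set S := \sum_(_ <= _ < _) _.
have e0 := expR_gt0 u; have ev : expR v = expR u * expR (B%:R * l) by rewrite vu expRD.
rewrite ev => /ler_normlP[H _].
have {}H : (2 * (expR (B%:R * l) - 1) - delta) * u * expR u - C * expR u <= S.
  have : (psie v - psie u) * u <= delta * expR u * u by rewrite ler_wpM2r.
  lra.
pose T i := (psie (i.+1%:R * l) - psie (i%:R * l)).
have up : S <= \sum_(0 <= i < J) T i *
      ((psie ((J - i + B)%:R * l) - psie ((J - i)%:R * l)) + T (J - i.+1)%N)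
    + (psie v - psie u) * psie (B%:R * l).
  (* Cells are open on the left, so the grid starts at [k = 2]; the lost term vanishes since
     [Lam 1 = 0]. *)
  have -> : S = \sum_((fl (0%:R * l)).+1 <= k < (fl v).+1)
      Lam k * (psie (v - ln k%:R) - psie (u - ln k%:R)).
    rewrite mul0r expR0 truncn1 /S big_ltn //; last first.
      by rewrite ltnS floor_exp_gt0 // (le_trans u0).
    by rewrite von_mangoldt1 mul0r add0r.
  rewrite (sum_grid_cells l0) // (big_cat_nat (n := J)) ?leq_addr //=.
  apply: lerD.
    rewrite big_nat_cond [leRHS]big_nat_cond; apply: ler_sum => i /andP[/andP[_ iJ] _].
    rewrite /T (grid_cell_sum l0 (leqnSn i)) mulr_suml.
    rewrite big_nat_cond [leRHS]big_nat_cond; apply: ler_sum => k /andP[/andP[k1 k2] _].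
    have k0 : (0 < k)%N by apply: leq_trans k1.
    apply: ler_wpM2l; first exact: von_mangoldt_ge0.
    have -> : (J - i.+1).+1 = (J - i)%N by lia.
    have lk1 : i%:R * l <= ln k%:R.
      by rewrite ltW // ltNge -leq_floor_exp // -ltnNge.
    have lk2 : ln k%:R <= i.+1%:R * l by rewrite -leq_floor_exp.
    have p1 : psie (v - ln k%:R) <= psie ((J - i + B)%:R * l).
      apply: psie_homo; have -> : (J - i + B)%:R * l = v - i%:R * l.
        by rewrite /v !natrD (natrB _ (ltnW iJ)); ring.
      by rewrite lerD2l lerN2.
    have p2 : psie ((J - i.+1)%:R * l) <= psie (u - ln k%:R).
      apply: psie_homo; have -> : (J - i.+1)%:R * l = u - i.+1%:R * l.
        by rewrite /u (natrB _ iJ); ring.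
      by rewrite lerD2l lerN2.
    lra.
  have -> : psie v - psie u = _ := grid_cell_sum l0 (leq_addr B J).
  rewrite mulr_suml -(sum_grid_cells l0 _ (leq_addr B J)).
  rewrite big_nat_cond [leRHS]big_nat_cond; apply: ler_sum => k /andP[/andP[k1 k2] _].
  have k0 : (0 < k)%N by apply: leq_trans k1.
  apply: ler_wpM2l; first exact: von_mangoldt_ge0.
  have := psie_ge0 (u - ln k%:R).
  have : psie (v - ln k%:R) <= psie (B%:R * l).
    apply: psie_homo; rewrite vu lerBlDr addrC lerD2l.
    by rewrite ltW // ltNge -leq_floor_exp // -ltnNge.
  lra.
have tail : (psie v - psie u) * psie (B%:R * l) <= 64 * expR 2 * expR u.
  have h1 := psie_le v; have h2 := psie_ge0 u; have h3 := psie_le (B%:R * l).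
  have h4 := psie_ge0 (B%:R * l).
  have d0 : 0 <= psie v - psie u by rewrite subr_ge0 psie_homo.
  have eB : expR (B%:R * l) <= expR 1 by rewrite ler_expR.
  have e2 : expR 2 = expR 1 * expR 1 :> R by rewrite -expRD.
  rewrite ev in h1.
  apply: (@le_trans _ _ ((8 * (expR u * expR 1)) * (8 * expR 1))).
    apply: ler_pM => //; last by apply: le_trans h3 _; rewrite ler_pM2l.
    have : expR u * expR (B%:R * l) <= expR u * expR 1 by rewrite ler_pM2l.
    lra.
  rewrite e2; nra.
rewrite -(ler_pM2r e0) mulr_suml.
have -> : \sum_(0 <= i < J) (expR l - 1) * grid_density l 1 i *
    ((expR (B%:R * l) - 1) * grid_density l B (J - i)%N +
     (expR l - 1) * grid_density l 1 (J - i.+1)%N) * expR u =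
  \sum_(0 <= i < J) T i *
      ((psie ((J - i + B)%:R * l) - psie ((J - i)%:R * l)) + expR l * T (J - i.+1)%N).
  apply: eq_big_nat => i /andP[_ iJ].
  have G k : psie (k.+1%:R * l) - psie (k%:R * l) =
      expR (k%:R * l) * (expR l - 1) * grid_density l 1 k.
    by have := grid_densityE l0 k (ltn0Sn 0); rewrite addn1 mul1r.
  rewrite /T (G i) (G (J - i.+1)%N) (grid_densityE l0 (J - i) B0).
  have -> : expR u = expR (i%:R * l) * expR ((J - i)%:R * l).
    by rewrite -expR_gridD subnKC // ltnW.
  have -> : expR ((J - i)%:R * l) = expR ((J - i.+1)%:R * l) * expR l.
    have := expR_gridD l (J - i.+1) 1; rewrite mul1r => <-.
    by congr (expR (_%:R * l)); clear -iJ; lia.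
  ring.
have q1 : 1 <= expR l by rewrite -expR0 ler_expR ltW.
have T0 i : 0 <= T i by rewrite subr_ge0 psie_homo // le_grid.
(* Cell [J - i - 1] lies one step lower than block [J - i], so normalizing by [expR u] produces an
   extra factor [expR l >= 1], which only enlarges the bound. *)
have : \sum_(0 <= i < J) T i *
      ((psie ((J - i + B)%:R * l) - psie ((J - i)%:R * l)) + T (J - i.+1)%N) <=
   \sum_(0 <= i < J) T i *
      ((psie ((J - i + B)%:R * l) - psie ((J - i)%:R * l)) + expR l * T (J - i.+1)%N).
  apply: ler_sum => i _; apply: ler_wpM2l => //; rewrite lerD2l.
  by rewrite ler_peMl.
have -> : ((2 * (expR (B%:R * l) - 1) - delta) * l * J%:R - (C + 64 * expR 2)) * expR u =
  (2 * (expR (B%:R * l) - 1) - delta) * u * expR u - C * expR u - 64 * expR 2 * expR u.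
  by rewrite /u; ring.
lra.
Qed.

End Grid.

(** * Every far block carries a positive share of mass *)

Section PrimeGaps.
Context {R : realType}.
Local Notation psie := (@psie R).
Local Notation fl u := (Num.truncn (expR u)).

Lemma natr_eventually_ge (x : R) : exists n0 : nat, forall n, (n0 <= n)%N -> x <= n%:R.
Proof.
exists (Num.truncn x).+1 => n xn; apply: le_trans (ltW (truncnS_gt x)) _.
by rewrite ler_nat.
Qed.

(** The step relation solved for [t - z], with the densities known to be at most 3. For
    [E = expR H - 1] the factor of [l] becomes the speed [kap], which depends on [H] only. *)
Lemma density_step_bound (l E q x y z t : R) :
  0 < E -> 0 < q - 1 <= 2 * l -> 0 <= x <= 3 -> 0 <= y <= 3 -> 0 <= t <= 3 ->
  q * E * t = E * z + (q - 1) * ((E + 1) * y - x) ->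
  `|t - z| <= (6 + 6 * (E + 1) / E) * l.
Proof.
move=> E0 /andP[q0 q1] /andP[x0 x1] /andP[y0 y1] /andP[t0 t1] id.
have b1 : (q - 1) * t <= 2 * l * 3 by apply: ler_pM => //; exact: ltW.
have b0 : 0 <= (q - 1) * t by rewrite mulr_ge0 // ltW.
have : `|(E + 1) * y - x| <= 3 * (E + 1).
  by rewrite ler_norml; apply/andP; split; nra.
set s := _ - x in id *; move=> hs.
have bnd : `|(q - 1) * s| <= 2 * l * (3 * (E + 1)).
  by rewrite normrM (gtr0_norm q0); apply: ler_pM => //; exact: ltW.
rewrite -(ler_pM2r E0) -{1}(gtr0_norm E0) -normrM.
have -> : (t - z) * E = - ((q - 1) * t * E) + (q - 1) * s by lra.
apply: le_trans (ler_normD _ _) _; rewrite normrN normrM (ger0_norm b0) (gtr0_norm E0).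
have -> : (6 + 6 * (E + 1) / E) * l * E = 2 * l * 3 * E + 2 * l * (3 * (E + 1)).
  by field; rewrite gt_eqF.
by apply: lerD => //; rewrite ler_pM2r.
Qed.

(** The Mertens error 22 is at most a fifth of [n l], and replacing [q - 1] by [l] costs a factor
    between [1 - l] and [1 + l]: the claims follow from [0.8 * 0.9 > 0.7] and [1.2 * 1.1 < 1.4]. *)
Lemma block_mean_bound (l q n S : R) : 0 < l <= 1 / 10 -> 0 < q - 1 ->
  q * l <= (1 + l) * (q - 1) -> (1 - l) * (q - 1) <= l ->
  110 <= n * l -> 0 <= S -> n * l - 22 <= (q - 1) * S <= q * (n * l + 22) ->
  7 / 10 * n <= S <= 14 / 10 * n.
Proof.
move=> /andP[l0 l1] q0 ql ql' nl S0 /andP[h1 h2].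
apply/andP; split; rewrite -(ler_pM2r l0).
  have : (1 - l) * (8 / 10 * (n * l)) <= (1 - l) * ((q - 1) * S).
    by rewrite ler_wpM2l //; lra.
  have := ler_wpM2r S0 ql'.
  have : 0 <= (1 / 10 - l) * (n * l) by rewrite mulr_ge0 //; lra.
  lra.
rewrite -(ler_pM2l q0).
have h3 : q * (n * l + 22) <= q * (12 / 10 * (n * l)) by rewrite ler_wpM2l //; lra.
have h4 : l * ((q - 1) * S) <= l * (q * (12 / 10 * (n * l))).
  by rewrite ler_wpM2l ?(ltW l0) //; lra.
have h5 : q * l * (12 / 10 * (n * l)) <= (1 + l) * (q - 1) * (12 / 10 * (n * l)).
  by rewrite ler_wpM2r //; lra.
have h6 : 0 <= (1 / 10 - l) * ((q - 1) * (n * l)).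
  by rewrite mulr_ge0 //; [lra|rewrite mulr_ge0 //; lra].
have h7 : 0 <= (q - 1) * (n * l) by rewrite mulr_ge0 //; lra.
lra.
Qed.

(** The spare [2 eta] pays for the mass [delta = eta * E] still allowed in the sparse block and for
    exchanging [q - 1] with [l]. *)
Lemma mesh_slack (l q eta : R) : 0 < l -> l <= eta / 2 -> eta <= 1 -> 0 < q - 1 ->
  (1 - l) * (q - 1) <= l -> (q - 1) * (2 - 2 * eta) <= (2 - eta) * l.
Proof.
move=> l0 le eta1 q0 ql.
have : (2 - eta) * ((1 - l) * (q - 1)) <= (2 - eta) * l by rewrite ler_wpM2l //; lra.
have : 0 <= (eta / 2 - l) * (q - 1) by rewrite mulr_ge0 //; lra.
have : 0 <= eta * (l * (q - 1)) by rewrite !mulr_ge0 //; lra.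
lra.
Qed.

(** Both [n] and [r] are of order [1 / l], so the proportion of good indices does not depend on the
    mesh: [(n + r) l <= 112], [r l >= 1 / (20 kap)], and [224 = 2 * 112]. *)
Lemma block_proportion (kap l n r : R) : 6 <= kap -> 0 < l <= 1 / 10 -> 0 < n + r ->
  n * l <= 110 + l -> 0 <= r -> r * (10 * kap * l) <= 1 ->
  20 * (kap * l) <= 1 -> 1 <= (r + 1) * (10 * kap * l) ->
  (20 * kap)^-1 / 224 <= r / 2 / (n + r).
Proof.
move=> k6 /andP[l0 l1] nr nl r0 rl1 kl rl2.
have k0 : 0 < kap by lra.
rewrite ler_pdivlMr // -(ler_pM2r l0).
have h1 : (n + r) * l <= 112.
  have rl : 0 <= r * l by rewrite mulr_ge0 // ltW.
  by have := ler_wpM2l rl k6; lra.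
have k20 : 0 < (20 * kap)^-1 by rewrite invr_gt0; lra.
have h2 : (20 * kap)^-1 <= r * l.
  by rewrite -div1r ler_pdivrMr; lra.
have := ler_wpM2l (ltW k20) h1; lra.
Qed.

(** [H] fixes [kap] and [c0], these fix [eta], and [eta] fixes the mesh. If block [J] had mass at
    most [delta * expR (J l)], then the sum of [w (2 - w)] up to [J] would be at least
    [(c0 - 3 eta) J] and at most [25 eta J], up to constants. As [28 eta < c0], this bounds [J]. *)
Lemma grid_gap_free (H : R) : 0 < H <= 1 -> exists l B delta J0,
  [/\ 0 < l <= H, (0 < B)%N, B%:R * l = H, 0 < delta &
  forall J, (J0 <= J)%N ->
    delta * expR (J%:R * l) < psie ((J + B)%:R * l) - psie (J%:R * l)].
Proof.
move=> /andP[H0 H1].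
pose E := expR H - 1; have E0 : 0 < E by rewrite subr_gt0 expR_gt1.
pose kap := 6 + 6 * expR H / E.
have kap6 : 6 <= kap by rewrite lerDl divr_ge0 ?mulr_ge0 ?expR_ge0 // ltW.
have kap0 : 0 < kap by lra.
pose c0 := (20 * kap)^-1 / 224.
have k20p : 0 < (20 * kap)^-1 by rewrite invr_gt0; lra.
have k20le : (20 * kap)^-1 <= 1 by rewrite invf_le1; lra.
have c00 : 0 < c0 by rewrite /c0; lra.
have c01 : c0 <= 1 by rewrite /c0; lra.
pose eta := c0 / 60; have eta0 : 0 < eta by rewrite /eta; lra.
have eta1 : eta <= 1 by rewrite /eta; lra.
have he : 0 < eta <= 1 by rewrite eta0.
(* In this order: room for [mesh_slack]; [(q - 1) / E <= eta], which makes the correlation of [a]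
   with itself negligible; the estimates of [q] and of block means; [r >= 1]. *)
pose l0 := Num.min (Num.min (eta / 2) (eta * E / 2)) (Num.min (1 / 10) (20 * kap)^-1).
have l00 : 0 < l0.
  have eE : 0 < eta * E by rewrite mulr_gt0.
  by rewrite !lt_min k20p andbT; apply/andP; split; [apply/andP; split|]; lra.
have [B1 HB1] := natr_eventually_ge (H / l0).
pose B := B1.+1; have B0 : (0 < B)%N by [].
have Bp : (0 : R) < B%:R by rewrite ltr0n.
pose l := H / B%:R; have lp : 0 < l by rewrite divr_gt0.
have Bl : B%:R * l = H by rewrite /l mulrC divfK // gt_eqF.
have ll0 : l <= l0.
  by rewrite /l ler_pdivrMr // -ler_pdivrMl // mulrC HB1.
have lH : l <= H by rewrite /l ler_pdivrMr // ler_peMr ?(ltW H0) // ler1n.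
have [l1 l2 l3 l4] : [/\ l <= eta / 2, l <= eta * E / 2, l <= 1 / 10 & l <= (20 * kap)^-1].
  by move: ll0; rewrite !le_min => /andP[/andP[-> ->] /andP[-> ->]].
pose q := expR l; have q1 : 1 + l <= q by rewrite expR_ge1Dx.
have q2 : q <= 1 + 2 * l by apply: expR_le_1D2; apply/andP; split; lra.
have q3 : q * (1 - l) <= 1.
  have := expR_ge1Dx (- l); rewrite expRN -/q => h.
  by rewrite mulrC -ler_pdivlMr ?expR_gt0 // div1r.
have p0 : 0 < q - 1 by lra.
exists l, B, (eta * E).
pose a i := grid_density l 1 i; pose w j := grid_density l B j.
pose A := Num.max (8 * q / (q - 1)) (8 * expR H / E).
have a_b i : 0 <= a i <= A.
  rewrite grid_density_ge0 //= le_max; apply/orP; left.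
  by have := grid_density_bounded lp i (ltn0Sn 0); rewrite mul1r.
have w_b i : 0 <= w i <= A.
  rewrite grid_density_ge0 //= le_max; apply/orP; right.
  by have := grid_density_bounded lp i B0; rewrite Bl.
have A0 : 0 <= A by have /andP[x y] := a_b 0%N; exact: le_trans y.
have [C1 [C10 HC1]] := @grid_density_le R.
have [I1 HI1] := natr_eventually_ge (C1 / (eta * (l * (q - 1)))).
have [I2 HI2] := natr_eventually_ge (C1 / (eta * (l * E))).
pose I0 := (I1 + I2).+1.
have a2 i : (I0 <= i)%N -> a i <= 2 + eta.
  move=> Ii; have i0 : (0 < i)%N by apply: leq_trans Ii.
  have := HC1 l 1%N i lp isT; rewrite mul1r => /(_ _ i0) h.
  apply: le_trans (h _) _; first by lra.
  have ip : (0 : R) < i%:R by rewrite ltr0n.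
  have lq : 0 < l * (q - 1) by rewrite mulr_gt0.
  rewrite lerD2l -/q -mulrA ler_pdivrMr; last by rewrite mulr_gt0.
  have Ii' : (I1 <= i)%N := leq_trans (leqW (leq_addr I2 I1)) Ii.
  by have := HI1 i Ii'; rewrite (ler_pdivrMr _ _ (mulr_gt0 eta0 lq)) mulrCA.
have w2 i : (I0 <= i)%N -> w i <= 2 + eta.
  move=> Ii; have i0 : (0 < i)%N by apply: leq_trans Ii.
  have := HC1 l B i lp isT; rewrite Bl => /(_ H1 i0) h.
  apply: le_trans h _.
  have ip : (0 : R) < i%:R by rewrite ltr0n.
  have lE : 0 < l * E by rewrite mulr_gt0.
  rewrite lerD2l -/E -mulrA ler_pdivrMr; last by rewrite mulr_gt0.
  have Ii' : (I2 <= i)%N := leq_trans (leqW (leq_addl I1 I2)) Ii.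
  by have := HI2 i Ii'; rewrite (ler_pdivrMr _ _ (mulr_gt0 eta0 lE)) mulrCA.
have ql : q * l <= (1 + l) * (q - 1) by lra.
have ql' : (1 - l) * (q - 1) <= l by lra.
pose K1 := 22 * q / (q - 1).
have K10 : 0 <= K1 by rewrite /K1 divr_ge0 ?mulr_ge0 ?expR_ge0 // ltW.
have [C3 [C30 HC3]] := @grid_selberg R.
pose K2 := K1 + C3 / ((q - 1) * E).
have K20 : 0 <= K2 by rewrite addr_ge0 // divr_ge0 // ltW // mulr_gt0.
have mean (D : nat) n : (0 < D)%N ->
   \sum_(0 <= i < n) grid_density l D i <= (1 + eta) * n%:R + K2.
  move=> D0; have /andP[_] := grid_mean lp 0 n D0; rewrite add0n -/q => h.
  apply: (@le_trans _ _ ((1 + eta) * n%:R + K1)); last first.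
    by rewrite lerD2l lerDl divr_ge0 // ltW // mulr_gt0.
  rewrite -(ler_pM2l p0); apply: le_trans h _.
  have -> : (q - 1) * ((1 + eta) * n%:R + K1) = (1 + eta) * (q - 1) * n%:R + q * 22.
    by rewrite /K1; field; rewrite gt_eqF.
  have n0 : 0 <= n%:R :> R by rewrite ler0n.
  have := ler_wpM2r n0 ql.
  have : l * (q - 1) * n%:R <= eta * (q - 1) * n%:R.
    by rewrite ler_wpM2r // ler_wpM2r ?(ltW p0) //; lra.
  lra.
have sa n : \sum_(0 <= i < n) a i <= (1 + eta) * n%:R + K2 by exact: mean.
have sw n : \sum_(0 <= i < n) w i <= (1 + eta) * n%:R + K2 by exact: mean.
have [K' HK'] := @autocorrelation_variance R a w A K2 eta I0 A0 K20 he a_b w_b a2 sa sw.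
(* [N l >= 110] makes the Mertens error at most a fifth; [r] is the number of steps of size
   [kap * l] that fit into 1/10. *)
pose N := (Num.truncn (110 / l)).+1; have N0 : (0 < N)%N by [].
pose r := Num.truncn (10 * kap * l)^-1.
have kl : 20 * (kap * l) <= 1.
  have k20 : 0 < 20 * kap by clear -kap0; lra.
  have := l4; rewrite -div1r ler_pdivlMr // => h; clear -h; lra.
have kl0 : 0 < kap * l by rewrite mulr_gt0.
have kl10 : 0 < 10 * kap * l by clear -kl0; lra.
have r0 : (0 < r)%N by rewrite truncn_gt0 invf_ge1 //; clear -kl kl0; lra.
have rl1 : r%:R * (10 * kap * l) <= 1.
  by rewrite -ler_pdivlMr // div1r truncn_le invr_ge0 ltW.
have rl2 : 1 <= (r%:R + 1) * (10 * kap * l).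
  by rewrite -ler_pdivrMr // div1r natr1 ltW // truncnS_gt.
have Nl1 : 110 <= N%:R * l by rewrite -ler_pdivrMr // ltW // truncnS_gt.
have Nl2 : N%:R * l <= 110 + l.
  have -> : N%:R = (Num.truncn (110 / l))%:R + 1 :> R by rewrite natr1.
  rewrite mulrDl mul1r lerD2r -ler_pdivlMr // truncn_le.
  by rewrite divr_ge0 // ltW.
have eta3 : 2 + eta <= 3 by clear -eta1; lra.
have q2' : q - 1 <= 2 * l by clear -q2; lra.
have l2' : 2 * l <= eta * E by clear -l2; lra.
have step j : (I0 <= j)%N -> `|w j.+1 - w j| * r%:R <= 10^-1.
  move=> Ij; have := grid_density_step lp j B0; rewrite Bl -/E -/q -!/(w _) -!/(a _).
  have /andP[x0 _] := a_b j; have /andP[y0 _] := a_b (j + B)%N.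
  have /andP[t0 _] := w_b j.+1.
  have x1 := le_trans (a2 _ Ij) eta3.
  have y1 := le_trans (a2 _ (leq_trans Ij (leq_addr B j))) eta3.
  have t1 := le_trans (w2 _ (leqW Ij)) eta3.
  rewrite -[expR H](subrK 1) -/E => id.
  have := @density_step_bound l E q (a j) (a (j + B)%N) (w j) (w j.+1) E0.
  rewrite p0 q2' x0 x1 y0 y1 t0 t1 => /(_ isT isT isT isT id).
  rewrite {1}/E subrK -/kap => key.
  have h := ler_wpM2r (ler0n R r) key; clear -h rl1; lra.
have block i : (I0 <= i)%N ->
     7 / 10 * N%:R <= \sum_(i <= j < i + N) w j <= 14 / 10 * N%:R.
  move=> _; have /andP[h1 h2] := grid_mean lp i N B0; rewrite -/q in h1 h2.
  apply: (@block_mean_bound l q) => //; rewrite ?lp ?h1 //.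
  by apply: sumr_ge0 => j _; have /andP[] := w_b j.
have [K4 HK4] := @variance_lower_bound R w A eta I0 N r N0 r0 he w_b w2 step block.
have c0r : c0 <= r%:R / 2 / (N + r)%:R.
  rewrite /c0 natrD; apply: (@block_proportion kap l) => //; rewrite ?lp //.
  by rewrite -natrD ltr0n addn_gt0 N0.
have [J1 HJ1] := natr_eventually_ge ((K' + K4 + 1) / (c0 - 28 * eta)).
exists J1; split => //; first by rewrite lp.
  by rewrite mulr_gt0.
move=> J JJ; rewrite ltNge; apply/negP => gap.
have cc : 0 < c0 - 28 * eta by rewrite /eta; clear -c00; lra.
have := HJ1 _ JJ; rewrite ler_pdivrMr // => big.
have lo := HK4 J.
have J0 : 0 <= J%:R :> R by rewrite ler0n.
suff up : \sum_(0 <= j < J) w j * (2 - w j) <= 25 * eta * J%:R + K'.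
  have h := ler_wpM2r J0 c0r; clear -h lo up big; lra.
apply: HK'.
have := HC3 l B J (eta * E) lp B0; rewrite Bl => /(_ H1 gap).
rewrite -/E -/q.
have -> : \sum_(0 <= i < J) (q - 1) * grid_density l 1 i *
    (E * grid_density l B (J - i)%N + (q - 1) * grid_density l 1 (J - i.+1)%N) =
  (q - 1) * E * (\sum_(0 <= i < J) a i * w (J - i)%N +
     (q - 1) / E * \sum_(0 <= i < J) a i * a (J - i.+1)%N).
  rewrite mulrDr !mulr_sumr -big_split /=; apply: eq_bigr => i _.
  by rewrite /a /w; field; rewrite gt_eqF.
set S1 := \sum_(_ <= _ < _) _; set S2 := \sum_(_ <= _ < _) _ => h.
have S20 : 0 <= S2.
  by apply: sumr_ge0 => i _; rewrite mulr_ge0 //; [have /andP[] := a_b i|have /andP[] := a_b (J - i.+1)%N].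
have h1 : (q - 1) / E <= eta by rewrite ler_pdivrMr // (le_trans q2').
have h2 : S1 + (q - 1) / E * S2 <= S1 + eta * S2 by rewrite lerD2l ler_wpM2r.
apply: le_trans h2; have qE : 0 < (q - 1) * E by rewrite mulr_gt0.
rewrite -(ler_pM2l qE); apply: le_trans h.
have -> : (q - 1) * E * ((2 - 2 * eta) * J%:R - K2) =
   E * ((q - 1) * (2 - 2 * eta)) * J%:R - (q - 1) * E * K1 - C3.
  by rewrite /K2; field; rewrite !gt_eqF.
have h3 := mesh_slack lp l1 eta1 p0 ql'.
have h4 : E * ((q - 1) * (2 - 2 * eta)) * J%:R <= E * ((2 - eta) * l) * J%:R.
  by rewrite ler_wpM2r // ler_wpM2l // ltW.
have h5 : 0 <= (q - 1) * E * K1 by rewrite mulr_ge0 // ltW.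
clear -h4 h5; lra.
Qed.

End PrimeGaps.

(** * From von Mangoldt mass to primes *)

Section ShortIntervals.
Context {R : realType}.
Local Notation Lam := (@von_mangoldt R).
Local Notation psie := (@psie R).
Local Notation fl u := (Num.truncn (expR u)).

Lemma von_mangoldt_le_ln (k : nat) : Lam k <= ln k%:R.
Proof.
rewrite /von_mangoldt; case: ifP => [/andP[k1 _]|_]; last exact: ln_natr_ge0.
have k0 := ltnW k1.
by rewrite ler_ln ?posrE ?ltr0n ?pdiv_gt0 // ler_nat pdiv_leq.
Qed.

Lemma von_mangoldt_proper (k : nat) : ~~ prime k -> Lam k != 0 ->
  exists p e, [/\ prime p, (1 < e)%N & k = (p ^ e)%N].
Proof.
rewrite /von_mangoldt; case: ifP => [/andP[k1 /eqP kE] kp _|]; last by rewrite eqxx.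
exists (pdiv k), (logn (pdiv k) k); split => //; first exact: pdiv_prime.
have : (0 < logn (pdiv k) k)%N by rewrite logn_gt0 pi_pdiv.
rewrite leq_eqVlt => /orP[/eqP e1|//].
by move: kp; rewrite kE -e1 expn1 pdiv_prime.
Qed.

Lemma ln2_ge_half : 1 / 2 <= ln 2 :> R.
Proof.
have := @ln_leB1 R 2^-1; rewrite invr_gt0 lnV ?posrE // => /(_ (ltr0Sn _ _)); lra.
Qed.

(** There are at most [(sqrt N + 1) (log_2 N + 1)] pairs of base and exponent, each of weight at
    most [ln N]; the two logarithms are absorbed into [N ^ (1/4)]. With [u = ln (sqrt N)],
    [8 u^2 + 2 u <= 132 N^(1/4)], and [264 = 2 * 132]. *)
Lemma sum_proper_prime_powers (N : nat) : (0 < N)%N ->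
  \sum_(1 <= k < N.+1 | ~~ prime k) Lam k <=
  264 * (Num.sqrt N%:R * Num.sqrt (Num.sqrt N%:R)).
Proof.
move=> N0; set y := Num.sqrt N%:R.
have N1 : 1 <= N%:R :> R by rewrite ler1n.
have y1 : 1 <= y by rewrite -sqrtr1 ler_wsqrtr.
have yy : y ^+ 2 = N%:R by rewrite sqr_sqrtr.
pose s := Num.truncn y; pose t := trunc_log 2 N.
pose L := [seq k <- index_iota 1 N.+1 | ~~ prime k && (Lam k != 0)].
have sizeL : (size L <= s.+1 * t.+1)%N.
  rewrite -(size_iota 0 s.+1) -(size_iota 0 t.+1).
  rewrite -(size_allpairs (fun p e => p ^ e)%N).
  apply: uniq_leq_size; first by rewrite filter_uniq // iota_uniq.
  move=> k; rewrite mem_filter mem_index_iota => /andP[/andP[kp kL] /andP[k0 kN]].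
  have [p [e [pp e1 kE]]] := von_mangoldt_proper kp kL.
  rewrite kE; apply: allpairs_f; rewrite mem_iota add0n ltnS /=.
    rewrite /s truncn_ge_nat ?(le_trans ler01) // -(ler_pXn2r (ltn0Sn 1)) ?nnegrE //; last first.
      by rewrite (le_trans ler01).
    rewrite yy -natrX ler_nat -ltnS (leq_trans _ kN) // ltnS kE.
    by rewrite leq_exp2l // prime_gt1.
  rewrite /t; apply: trunc_log_max => //.
  apply: leq_trans (_ : k <= N)%N; last by rewrite -ltnS.
  by rewrite kE leq_exp2r ?prime_gt1 // ltnW.
have l0 := @ln_natr_ge0 R N.
have -> : \sum_(1 <= k < N.+1 | ~~ prime k) Lam k = \sum_(k <- L) Lam k.
  rewrite /L big_filter [in RHS]big_mkcondr /=; apply: eq_bigr => k _.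
  by case: eqP.
have t_le : t%:R <= 2 * ln N%:R :> R.
  have : (2 ^ t <= N)%N by apply: trunc_logP.
  rewrite -(ler_nat R) natrX => h.
  have : ln (2 ^+ t) <= ln N%:R :> R by rewrite ler_ln // posrE ?exprn_gt0 ?ltr0n.
  rewrite lnXn // -[ln 2 *+ t]mulr_natl; have := ler_wpM2l (ler0n R t) ln2_ge_half; lra.
have s_le : s%:R <= y by rewrite truncn_le (le_trans ler01).
apply: (@le_trans _ _ ((s.+1 * t.+1)%:R * ln N%:R)).
  apply: (@le_trans _ _ (\sum_(k <- L) ln N%:R)); last first.
    rewrite big_const_seq count_predT iter_addr addr0 -[_ *+ size L]mulr_natl.
    by rewrite ler_wpM2r // ler_nat.
  rewrite big_seq [leRHS]big_seq; apply: ler_sum => k.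
  rewrite mem_filter mem_index_iota => /andP[_ /andP[k0 kN]].
  apply: le_trans (von_mangoldt_le_ln k) _.
  by rewrite ler_ln ?posrE ?ltr0n // ler_nat -ltnS.
have lN : ln N%:R = 2 * ln y by rewrite -yy lnXn ?mulr_natl // (lt_le_trans ltr01).
have ly0 := ln_ge0 y1; have ly1 := ln_le_2sqrt y1; have ly2 := ln_sqr_le y1.
rewrite natrM -!natr1; rewrite lN in t_le *.
set v := Num.sqrt y in ly1 ly2 *; set u := ln y in t_le ly0 ly1 ly2 *.
have h1 : s%:R + 1 <= 2 * y by lra.
have h2 : (t%:R + 1) * (2 * u) <= (4 * u + 1) * (2 * u) by rewrite ler_wpM2r //; lra.
rewrite -mulrA.
apply: (@le_trans _ _ ((2 * y) * ((4 * u + 1) * (2 * u)))).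
  have t0 : 0 <= t%:R :> R by rewrite ler0n.
  by apply: ler_pM => //; rewrite mulr_ge0 //; lra.
have h3 : (4 * u + 1) * (2 * u) <= 132 * v by move: ly2; rewrite expr2; lra.
have y0 : 0 <= 2 * y by lra.
have := ler_wpM2l y0 h3; lra.
Qed.

(** The block starts at the first grid point beyond [ln x], hence ends before [ln x + l + H <= ln x
    + 2 H <= ln ((1 + eps) x)]. Without primes its mass, at least [delta * x], would come from
    proper prime powers alone, which carry only [O(x ^ (3/4))]. *)
Lemma prime_in_short_interval (eps : R) : 0 < eps -> exists X : R, forall x, X <= x ->
  exists p, [/\ prime p, x < p%:R & p%:R <= (1 + eps) * x].
Proof.
move=> e0; pose H := Num.min 1 (ln (1 + eps) / 2).
have le0 : 0 < ln (1 + eps) by rewrite ln_gt0; lra.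
have H0 : 0 < H <= 1.
  by rewrite lt_min ltr01 ge_min lexx /= andbT divr_gt0.
have H2 : 2 * H <= ln (1 + eps).
  have : H <= ln (1 + eps) / 2 by rewrite ge_min lexx orbT.
  lra.
have [l [B [delta [J0 [/andP[l0 lH] B0 Bl d0 HJ]]]]] := grid_gap_free H0.
(* Beyond [T ^+ 4] the fourth root of [(1 + eps) x] exceeds [T], and [delta * x] beats the prime
   power bound. *)
pose T := 264 * (1 + eps) / delta.
exists (Num.max 1 (Num.max (T ^+ 4) (expR (J0%:R * l)))) => x.
rewrite !ge_max => /and3P[x1 xT xJ]; have x0 : 0 < x by lra.
apply: contrapT => no.
pose J := (Num.truncn (ln x / l)).+1.
have J1 : ln x < J%:R * l by rewrite -ltr_pdivrMr // truncnS_gt.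
have J2 : J%:R * l <= ln x + l.
  have -> : J%:R = (Num.truncn (ln x / l))%:R + 1 :> R by rewrite natr1.
  rewrite mulrDl mul1r lerD2r -ler_pdivlMr // truncn_le divr_ge0 ?ln_ge0 //.
  exact: ltW.
have JJ : (J0 <= J)%N.
  rewrite -(ler_nat R) -(ler_pM2r l0) ltW //; apply: le_lt_trans J1.
  by rewrite -[leLHS]expRK ler_ln ?posrE ?expR_gt0.
have := HJ J JJ; have xe : x <= expR (J%:R * l).
  by rewrite -{1}(lnK x0) ler_expR ltW.
have ve : expR ((J + B)%:R * l) <= (1 + eps) * x.
  rewrite natrD mulrDl Bl -[leRHS]lnK ?posrE ?mulr_gt0 //; last by lra.
  rewrite ler_expR lnM ?posrE //; lra.
set v := (J + B)%:R * l in ve *; set u := J%:R * l in xe *.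
have uv : u <= v by rewrite le_grid // leq_addr.
set N := fl v; have N0 : (0 < N)%N.
  by rewrite floor_exp_gt0 // /v mulr_ge0 ?ler0n // ltW.
have cells : psie v - psie u <= \sum_(1 <= k < N.+1 | ~~ prime k) Lam k.
  have -> : psie v - psie u = _ := grid_cell_sum l0 (leq_addr B J).
  rewrite -/u -/v -/N [leRHS](big_cat_nat (n := (fl u).+1)) //=; last first.
    by rewrite ltnS le_truncn // ler_expR.
  rewrite -[leLHS]add0r; apply: lerD.
    by apply: sumr_ge0 => k _; exact: von_mangoldt_ge0.
  rewrite [leRHS]big_mkcond big_nat_cond [leRHS]big_nat_cond.
  apply: ler_sum => k /andP[/andP[k1 k2] _].
  case: ifP => // /negbFE kp; exfalso; apply: no; exists k; split => //.
    by apply: le_lt_trans xe _; rewrite -truncn_lt_nat ?expR_ge0.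
  by apply: le_trans ve; rewrite -truncn_ge_nat ?expR_ge0.
move=> gap; have := le_trans cells (sum_proper_prime_powers N0).
pose z := Num.sqrt ((1 + eps) * x).
have Nx : N%:R <= (1 + eps) * x by apply: le_trans ve; rewrite truncn_le expR_ge0.
have yz : Num.sqrt N%:R <= z by rewrite ler_wsqrtr.
have yz' : Num.sqrt (Num.sqrt N%:R) <= Num.sqrt z by rewrite ler_wsqrtr.
have up : Num.sqrt N%:R * Num.sqrt (Num.sqrt N%:R) <= z * Num.sqrt z.
  by apply: ler_pM => //; exact: sqrtr_ge0.
have ex0 : 0 <= (1 + eps) * x by rewrite mulr_ge0 //; lra.
have zz : z ^+ 2 = (1 + eps) * x by rewrite sqr_sqrtr.
have z0 : 0 <= z by exact: sqrtr_ge0.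
have ww : Num.sqrt z ^+ 2 = z by rewrite sqr_sqrtr.
have w0 : 0 < Num.sqrt z.
  by rewrite sqrtr_gt0 sqrtr_gt0 mulr_gt0 //; lra.
have T0 : 0 <= T.
  by apply: divr_ge0 (ltW d0); apply: mulr_ge0; [exact: ler0n|clear -e0; lra].
have wT : T <= Num.sqrt z.
  rewrite -(@ler_pXn2r R 4 isT) ?nnegrE ?(ltW w0) //.
  rewrite -[4%N]/(2 * 2)%N [leRHS]exprM ww zz; apply: le_trans xT _.
  by rewrite ler_peMl ?(ltW x0) // lerDl ltW.
have : delta * x <= delta * expR u by rewrite ler_pM2l.
have : 264 * (1 + eps) <= Num.sqrt z * delta by rewrite -ler_pdivrMr.
set w := Num.sqrt z in ww w0 up *.
move=> h1 h2 h3.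
have : 264 * (1 + eps) * (z * w) <= w * delta * (z * w) by rewrite ler_wpM2r // mulr_ge0 // ltW.
have -> : w * delta * (z * w) = delta * ((1 + eps) * x).
  transitivity (delta * (w ^+ 2 * z)); first by ring.
  by rewrite ww -zz; ring.
have e1 : 0 < 1 + eps by lra.
have h4 : delta * x < 264 * (z * w) by lra.
have := ltr_pM2l e1 (delta * x) (264 * (z * w)); rewrite h4; lra.
Qed.

End ShortIntervals.

(** * Lower bound for the number of Sidon sets *)

Lemma sidonP (n : nat) (S : {set 'I_n.+1}) :
  reflect (forall w x y z, w \in S -> x \in S -> y \in S -> z \in S ->
     (w + x = y + z :> nat)%N -> [set w; x] = [set y; z]) (sidon S).
Proof.
apply: (iffP idP) => [|H].
  move=> Sd w x y z wS xS yS zS E; apply/eqP/negPn/negP => ne; case/negP: Sd.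
  apply/existsP; exists w; rewrite wS; apply/existsP; exists x; rewrite xS.
  apply/existsP; exists y; rewrite yS; apply/existsP; exists z; rewrite zS /=.
  by rewrite E eqxx.
apply/negP => /existsP[w /andP[wS /existsP[x /andP[xS /existsP[y /andP[yS]]]]]].
case/existsP=> z /andP[zS /andP[/eqP E /negP]]; apply.
by apply/eqP; apply: H.
Qed.

Lemma exists_primitive_root_Fp (p : nat) : prime p ->
  exists z : 'F_p, (p.-1).-primitive_root z.
Proof.
move=> pp; pose rs := enum [pred x : 'F_p | x != 0].
have p1 := prime_gt1 pp.
have szr : size rs = p.-1.
  by rewrite -cardE; have := cardC1 (0 : 'F_p); rewrite card_Fp // => <-.
have : has (p.-1).-primitive_root rs.
  apply: has_prim_root; rewrite ?szr ?enum_uniq //; first by lia.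
  apply/allP => x; rewrite mem_enum inE => x0; apply/unity_rootP.
  apply: (mulfI x0); rewrite mulr1 -exprS prednK ?prime_gt0 //.
  by have := expf_card x; rewrite card_Fp.
by case/hasP => z _ hz; exists z.
Qed.

Lemma eq_sum_prod {F : fieldType} (a b c d : F) : a + b = c + d -> a * b = c * d ->
  (a = c /\ b = d) \/ (a = d /\ b = c).
Proof.
move=> s pr; have : (a - c) * (a - d) == 0.
  have -> : (a - c) * (a - d) = a * a - a * (c + d) + c * d by ring.
  by rewrite -s -pr; apply/eqP; ring.
rewrite mulf_eq0 !subr_eq0 => /orP[] /eqP E; [left|right]; split => //.
  by apply: (addrI a); rewrite s E.
by apply: (addrI a); rewrite s E addrC.
Qed.

(** * Ruzsa's Sidon set modulo [p (p - 1)], and its lifts *)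

Section Ruzsa.
Context (p : nat) (p_prime : prime p) (p_gt2 : (2 < p)%N).
Local Notation m := (p * p.-1)%N.

Lemma coprime_predn : coprime p p.-1.
Proof. by rewrite prime_coprime // gtnNdvd //; lia. Qed.

(** A sum [c i + c j] reveals [g ^ i + g ^ j] modulo [p], and [i + j] modulo [p - 1], hence the
    product [g ^ i * g ^ j]. Sum and product determine an unordered pair of field elements. *)
Lemma ruzsa_sidon_mod : exists c : 'I_p.-1 -> nat,
  [/\ forall i, (c i < m)%N, injective c &
   forall i j k l, (c i + c j = c k + c l %[mod m])%N ->
    (i = k /\ j = l) \/ (i = l /\ j = k)].
Proof.
have [g gP] := exists_primitive_root_Fp p_prime.
have p0 := prime_gt0 p_prime; have p10 : (0 < p.-1)%N by lia.
have m0 : (0 < m)%N by rewrite muln_gt0 p0.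
pose c (i : 'I_p.-1) := (chinese p p.-1 (g ^+ i : 'F_p) i %% m)%N.
have c_p i : (c i = (g ^+ i : 'F_p) %[mod p])%N.
  by rewrite /c modn_dvdm ?dvdn_mulr // chinese_modl // coprime_predn.
have c_p1 i : (c i = i %[mod p.-1])%N.
  by rewrite /c modn_dvdm ?dvdn_mull // chinese_modr // coprime_predn.
have key i j k l : (c i + c j = c k + c l %[mod m])%N ->
    (i = k /\ j = l) \/ (i = l /\ j = k).
  move=> E.
  have E1 : (i + j = k + l %[mod p.-1])%N.
    have := congr1 (fun x => x %% p.-1)%N E; rewrite /= !modn_dvdm ?dvdn_mull //.
    by rewrite -modnDm !c_p1 modnDm -[in RHS]modnDm !c_p1 modnDm.
  have E2 : g ^+ i + g ^+ j = g ^+ k + g ^+ l.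
    have val_nat (x : 'F_p) : x = (x : nat)%:R by rewrite natr_Zp.
    have cF x : (c x)%:R = g ^+ x :> 'F_p.
      by rewrite [RHS]val_nat -[LHS](Fp_nat_mod p_prime) c_p Fp_nat_mod.
    have := congr1 (fun x => x %% p)%N E; rewrite /= !modn_dvdm ?dvdn_mulr //.
    move=> /(congr1 (fun x : nat => x%:R : 'F_p)).
    by rewrite !Fp_nat_mod // !natrD !cF.
  have E3 : g ^+ i * g ^+ j = g ^+ k * g ^+ l.
    by rewrite -!exprD; apply/eqP; rewrite (eq_prim_root_expr gP) E1.
  have inj (x y : 'I_p.-1) : g ^+ x = g ^+ y -> x = y.
    move/eqP; rewrite (eq_prim_root_expr gP) !modn_small // => /eqP.
    exact: val_inj.
  by case: (eq_sum_prod E2 E3) => -[/inj-> /inj->]; [left|right].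
exists c; split => //; first by move=> i; rewrite ltn_mod.
by move=> i j E; case: (key i i j j); rewrite ?E // => -[].
Qed.

End Ruzsa.

(** The 5 options per residue are omission or one of four lifts. Equal sums of lifts have equal
    residues, so the residue pairs agree; with a single lift per residue the elements agree too. *)
Lemma num_sidon_ge (p n : nat) : prime p -> (2 < p)%N -> (4 * (p * p.-1) <= n)%N ->
  (5 ^ p.-1 <= num_sidon n)%N.
Proof.
move=> pp p2 mn; set m := (p * p.-1)%N in mn *.
have [c [cm cinj csid]] := ruzsa_sidon_mod pp p2; rewrite -/m in cm csid.
(* The shift by one avoids 0 and keeps the largest lift within [4 m <= n], so [inord] preserves
   values. *)
pose e (i : 'I_p.-1) (a : 'I_4) : 'I_n.+1 := inord (c i + a * m).+1.
have eE i a : e i a = (c i + a * m).+1 :> nat.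
  rewrite inordK // ltnS; apply: leq_trans mn.
  by have := cm i; have := ltn_ord a; nia.
have einj i a j b : e i a = e j b -> i = j /\ a = b.
  move=> /(congr1 val); rewrite /= !eE => -[E].
  have cij : c i = c j.
    by have := congr1 (modn^~ m) E; rewrite /= !(addnC (c _)) !modnMDl !modn_small.
  split; first exact: cinj.
  apply: val_inj => /=; move/eqP: E; rewrite cij eqn_add2l eqn_pmul2r => [/eqP //|].
  by apply: leq_ltn_trans (cm i).
pose T (f : {ffun 'I_p.-1 -> option 'I_4}) : {set 'I_n.+1} :=
  [set x | [exists i, if f i is Some a then x == e i a else false]].
have TP (f : {ffun 'I_p.-1 -> option 'I_4}) x : reflect (exists i a, f i = Some a /\ x = e i a) (x \in T f).
  rewrite inE; apply: (iffP existsP) => [[i]|[i [a [fi ->]]]].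
    by case E : (f i) => [a|//] /eqP->; exists i, a.
  by exists i; rewrite fi.
have Tinj : injective T.
  move=> f h E; apply/ffunP => i.
  have sub (f' h' : {ffun 'I_p.-1 -> option 'I_4}) : T f' = T h' -> forall a, f' i = Some a -> h' i = Some a.
    move=> E' a fa; have : e i a \in T f' by apply/TP; exists i, a.
    rewrite E' => /TP[j [b [hb /einj[-> ->]]]]; exact: hb.
  case fi : (f i) => [a|]; first by rewrite (sub _ _ E _ fi).
  by case hi : (h i) => [a|//]; rewrite (sub _ _ (esym E) _ hi) in fi.
have Tsid (f : {ffun 'I_p.-1 -> option 'I_4}) : sidon (T f).
  apply/sidonP => w x y z /TP[i [ai [fi ->]]] /TP[j [aj [fj ->]]].
  move=> /TP[k [ak [fk ->]]] /TP[l [al [fl' ->]]].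
  rewrite !eE => E.
  have : (c i + c j = c k + c l %[mod m])%N.
    have : ((c i + c j) + (ai + aj) * m = (c k + c l) + (ak + al) * m)%N by lia.
    by move=> /(congr1 (modn^~ m)); rewrite /= !(addnC (_ + c _)%N) !modnMDl.
  case/csid => -[ik jl]; subst.
    have -> : ai = ak by move: fi; rewrite fk => -[].
    by have -> : aj = al by move: fj; rewrite fl' => -[].
  have -> : ai = al by move: fi; rewrite fl' => -[].
  have -> : aj = ak by move: fj; rewrite fk => -[].
  by rewrite finset.setUC.
have -> : (5 ^ p.-1 = #|{ffun 'I_p.-1 -> option 'I_4}|)%N.
  by rewrite card_ffun card_option !card_ord.
rewrite -cardsT -(card_imset _ Tinj) /num_sidon; apply: subset_leq_card.
apply/fintype.subsetP => S /imsetP[f _ ->]; rewrite inE Tsid andbT.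
by apply/fintype.subsetP => x /TP[i [a [_ ->]]]; rewrite inE eE.
Qed.

Section LowerBound.
Context {R : realType}.

(* [65/28] is a convergent of [log_2 5], and [65/56 > 1.16]. *)
Lemma ln2_ln5 : 65 * ln 2 <= 28 * ln 5 :> R.
Proof.
have h : 2 ^+ 65 <= 5 ^+ 28 :> R by lra.
have : ln (2 ^+ 65) <= ln (5 ^+ 28) :> R by rewrite ler_ln // posrE exprn_gt0.
by rewrite !lnXn // -[ln 2 *+ 65]mulr_natl -[ln 5 *+ 28]mulr_natl.
Qed.

Lemma num_sidon_lower : exists n0 : nat, forall n, (n0 <= n)%N ->
  expR (116 / 100 * Num.sqrt n%:R * ln 2) <= (num_sidon n)%:R :> R.
Proof.
(* [65/56] exceeds [1.16] by a relative 0.0006; [eps], and the loss of one in [p - 1] once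
   [sqrt n >= 10^4], spend less than that. *)
pose eps : R := (40 * 100)^-1.
have e0 : 0 < eps by rewrite invr_gt0.
have [X HX] := prime_in_short_interval e0.
pose Y : R := Num.max (2 * (1 + eps) * X) (100 * 100).
have [n0 Hn0] := natr_eventually_ge (Y ^+ 2).
exists n0 => n /Hn0 nY; set s := Num.sqrt n%:R.
have Y0 : 0 <= Y by rewrite le_max; apply/orP; right.
have sY : Y <= s.
  by rewrite -[Y]ger0_norm // -sqrtr_sqr ler_wsqrtr.
move: sY; rewrite ge_max => /andP[s1 s2].
have e1 : 0 < 2 * (1 + eps) by lra.
have s3 : X <= s / (2 * (1 + eps)) by rewrite ler_pdivlMr // mulrC.
have [p [pp p1 p2]] := HX _ s3.
have {}p2 : p%:R <= s / 2.
  have -> : s / 2 = (1 + eps) * (s / (2 * (1 + eps))) by field; rewrite gt_eqF //; lra.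
  by [].
have {}p1 : s * (4000 / 4001) / 2 < p%:R.
  have -> : s * (4000 / 4001) / 2 = s / (2 * (1 + eps)); last by [].
  by rewrite /eps; field.
have s0 : 0 <= s by exact: sqrtr_ge0.
have ss : s ^+ 2 = n%:R by rewrite sqr_sqrtr.
have p3 : (2 < p)%N by rewrite -(ltr_nat R); lra.
have pn : (4 * (p * p.-1) <= n)%N.
  apply: (@leq_trans (4 * (p * p))); first by rewrite !leq_mul2l leq_pred !orbT.
  rewrite -(ler_nat R) !natrM -ss expr2.
  have p0 : 0 <= p%:R :> R by rewrite ler0n.
  have h := ler_pM p0 p0 p2 p2; clear -h; lra.
apply: (@le_trans _ _ ((5 ^ p.-1)%N%:R)); last by rewrite ler_nat num_sidon_ge.
rewrite natrX -[5 in leRHS](@lnK R) ?posrE // -expRM_natl ler_expR.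
have pE : p%:R = p.-1%:R + 1 :> R by rewrite natr1 prednK // prime_gt0.
rewrite pE in p1.
have l0 : 0 <= ln 2 :> R by rewrite ln_ge0 // ler1n.
have l5 := ln2_ln5.
have q0 : 0 <= p.-1%:R :> R by rewrite ler0n.
have h1 := ler_wpM2l q0 l5.
have h2 : 28 * (116 / 100 * s) <= p.-1%:R * 65 by clear -p1 s2; lra.
have h3 := ler_wpM2r l0 h2; clear -h1 h3; lra.
Qed.

(** [ln 2 = ln 8 - ln 4] is split at 5, 6 and 7, so that it is at least
    [1/5 + 1/6 + 1/7 + 1/8 > 0.634]. It converts [exp (34 sqrt n)] into a power of 2 with exponent
    [55 sqrt n]. *)
Lemma ln2_lower : 34 / 55 <= ln 2 :> R.
Proof.
have h (a b : R) : 0 < a -> 0 < b -> 1 - b / a <= ln a - ln b.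
  move=> a0 b0; have := @ln_leB1 R (b / a); rewrite divr_gt0 // ln_div ?posrE //.
  by move=> /(_ isT); lra.
have h1 := h 5 4 (ltr0Sn _ _) (ltr0Sn _ _); have h2 := h 6 5 (ltr0Sn _ _) (ltr0Sn _ _).
have h3 := h 7 6 (ltr0Sn _ _) (ltr0Sn _ _); have h4 := h 8 7 (ltr0Sn _ _) (ltr0Sn _ _).
have : ln 8 = ln 4 + ln 2 :> R by rewrite -lnM ?posrE //; congr ln; lra.
lra.
Qed.

End LowerBound.

(** * Upper bound for the number of Sidon sets *)

Section HardCore.
Context {R : realType} {T : finType} (e : rel T).
Context (e_sym : symmetric e) (e_irr : irreflexive e).
Implicit Types (U V I : {set T}) (v : T) (x : R) (q : nat).

Definition independent I := [forall v in I, forall w in I, ~~ e v w].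

Lemma independentP I :
  reflect (forall v w, v \in I -> w \in I -> ~~ e v w) (independent I).
Proof.
apply: (iffP forall_inP) => [H v w vI wI|H v vI].
  by have /forall_inP := H v vI; apply.
by apply/forall_inP => w; exact: H.
Qed.

(** The independence polynomial at [x], or partition function of the hard-core gas. It obeys a
    recursion free of sizes; the count for one size [t] is recovered at the end by dividing by
    [x ^+ t]. *)
Definition hard_core x U : R :=
  \sum_(I : {set T} | (I \subset U) && independent I) x ^+ #|I|.

Lemma hard_core_ge0 x U : 0 <= x -> 0 <= hard_core x U.
Proof. by move=> x0; apply: sumr_ge0 => I _; rewrite exprn_ge0. Qed.

Lemma hard_core0 x : hard_core x finset.set0 = 1.
Proof.
rewrite /hard_core (big_pred1 finset.set0) ?cards0 // => I /=.
rewrite finset.subset0; have [->|_] := eqVneq I finset.set0; last by [].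
by rewrite andTb; apply/independentP => v w; rewrite finset.in_set0.
Qed.

Lemma hard_core_mono x U V : 0 <= x -> V \subset U -> hard_core x V <= hard_core x U.
Proof.
move=> x0 VU; rewrite /hard_core big_mkcond [leRHS]big_mkcond /=.
apply: ler_sum => I _; case: ifP => [/andP[IV ->]|_].
  by rewrite (fintype.subset_trans IV VU).
by case: ifP => // _; rewrite exprn_ge0.
Qed.

Lemma hard_core_rec x U v : v \in U ->
  hard_core x U = hard_core x (U :\ v) + x * hard_core x [set w in U :\ v | ~~ e v w].
Proof.
move=> vU; rewrite /hard_core (bigID (fun I : {set T} => v \notin I)) /=; congr (_ + _).
  apply: eq_bigl => I; rewrite finset.subsetD1.
  by case: (I \subset U) => //=; case: (v \in I); rewrite ?andbF ?andbT.
rewrite mulr_sumr.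
rewrite (reindex_onto (fun I => v |: I) (fun I => I :\ v)) /=; last first.
  by move=> I /andP[_ /negPn vI]; rewrite finset.setD1K.
apply: eq_big => [I|I /andP[_ /eqP vI]]; last first.
  have vI' : v \notin I by rewrite -vI finset.setD11.
  by rewrite cardsU1 vI' add1n exprS.
rewrite finset.setU11 /= andbT.
apply/andP/andP => [[/andP[vIU ind] /eqP vI]|[IU ind]].
  have vI' : v \notin I by rewrite -vI finset.setD11.
  have /independentP H := ind; split.
    apply/fintype.subsetP => w wI; rewrite !inE.
    have wv : w != v by apply: contraNneq vI' => <-.
    rewrite wv /=; have /fintype.subsetP -> /= := vIU; last by rewrite !inE wI orbT.
    by apply: H; rewrite !inE ?eqxx // wI orbT.
  by apply/independentP => a b aI bI; apply: H; rewrite !inE ?aI ?bI orbT.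
have vI : v \notin I.
  by apply/negP => vI; have /fintype.subsetP/(_ v vI) := IU; rewrite !inE eqxx.
split; last by rewrite finset.setU1K.
apply/andP; split.
  apply/fintype.subsetP => w; rewrite !inE => /orP[/eqP->//|wI].
  by have /fintype.subsetP/(_ w wI) := IU; rewrite !inE => /andP[/andP[_ ->]].
apply/independentP => a b; rewrite !inE.
have nb w : w \in I -> ~~ e v w.
  by move=> wI; have /fintype.subsetP/(_ w wI) := IU; rewrite !inE => /andP[].
move=> /orP[/eqP->|aI] /orP[/eqP->|bI]; rewrite ?e_irr // ?nb //.
  by rewrite e_sym nb.
by have /independentP := ind; apply.
Qed.

Lemma hard_core_le_expR x U : 0 <= x -> hard_core x U <= expR (x * #|U|%:R).
Proof.
move=> x0; elim: {U}#|U| {-2}U (erefl #|U|) => [|k IH] U cU.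
  by rewrite (cards0_eq cU) hard_core0 cards0 mulr0 expR0.
have [v vU] : exists v, v \in U by apply/card_gt0P; rewrite cU.
have cU1 : #|U :\ v| = k by have := cardsD1 v U; rewrite vU cU add1n => -[].
rewrite (hard_core_rec x vU).
have h : hard_core x [set w in U :\ v | ~~ e v w] <= hard_core x (U :\ v).
  by apply: hard_core_mono => //; apply/fintype.subsetP => w; rewrite inE => /andP[].
have := IH _ cU1; rewrite cU1 cU -[k.+1%:R]natr1 mulrDr mulr1 expRD.
have := expR_ge1Dx x; have := ler_wpM2l x0 h; have := expR_gt0 (x * k%:R).
have := @hard_core_ge0 x (U :\ v) x0.
set a := hard_core _ _; set b := hard_core _ _; set c := expR _; set d := expR _.
nra.
Qed.

(* Kleitman--Winston: each vertex put in the independent set removes a fraction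
   [beta] of the remaining candidates, so at most [q] of the choices made before
   only [r] candidates are left can be "put in". *)
Lemma hard_core_bound x (beta r : R) q U : 0 <= x <= 1 -> 0 <= beta <= 1 ->
  (forall V, r < #|V|%:R ->
     exists2 v, v \in V & beta * #|V|%:R <= #|[set w in V | e v w]|%:R) ->
  #|U|%:R * (1 - beta) ^+ q <= r ->
  hard_core x U <= #|U|.+1%:R ^+ q * expR (x * r).
Proof.
move=> /andP[x0 x1] /andP[b0 b1] deg.
move: {2}#|U|.+1 (ltnSn #|U|) => k; elim: k q U => // k IH q U Uk Uq.
have [Ur|Ur] := leP #|U|%:R r.
  apply: le_trans (hard_core_le_expR U x0) _.
  apply: (@le_trans _ _ (expR (x * r))); first by rewrite ler_expR ler_wpM2l.
  by rewrite ler_peMl ?expR_ge0 // exprn_ege1 // ler1n.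
case: q Uq => [|q] Uq; first by move: Uq; rewrite expr0 mulr1 leNgt Ur.
have [v vU dv] := deg U Ur.
have cU1 : #|U| = #|U :\ v|.+1 by rewrite (cardsD1 v U) vU.
set U1 := U :\ v in cU1; set U2 := [set w in U1 | ~~ e v w].
have U2U : U2 \subset U1 by apply/fintype.subsetP => w; rewrite inE => /andP[].
have cU2 : (#|U2| <= #|U1|)%N by exact: subset_leq_card.
have cU2' : #|U2|%:R <= (1 - beta) * #|U|%:R.
  rewrite mulrBl mul1r lerBrDr; apply: le_trans (lerD (lexx _) dv) _.
  rewrite -natrD ler_nat -cardsUI.
  have -> : U2 :&: [set w in U | e v w] = finset.set0.
    by apply/finset.setP => w; rewrite !inE; case: (e v w); rewrite ?andbF.
  rewrite cards0 addn0; apply: subset_leq_card; apply/fintype.subsetP => w.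
  by rewrite !inE => /orP[/andP[/andP[_ ->]]|/andP[->]].
have b1' : 0 <= 1 - beta by lra.
have h1 : hard_core x U1 <= #|U|%:R ^+ q.+1 * expR (x * r).
  rewrite cU1; apply: IH; first by rewrite -cU1 -ltnS.
  apply: le_trans Uq; rewrite ler_wpM2r ?exprn_ge0 // ler_nat cU1.
  exact: leqnSn.
have h2 : hard_core x U2 <= #|U|%:R ^+ q * expR (x * r).
  apply: (@le_trans _ _ (#|U2|.+1%:R ^+ q * expR (x * r))).
    apply: IH; first by apply: leq_ltn_trans cU2 _; rewrite -cU1 -ltnS.
    apply: le_trans Uq; rewrite exprS mulrA ler_wpM2r ?exprn_ge0 //.
    by rewrite mulrC.
  rewrite ler_wpM2r ?expR_ge0 // lerXn2r ?nnegrE ?ler0n // ler_nat cU1.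
  by rewrite ltnS.
rewrite (hard_core_rec x vU) -/U1 -/U2.
have h3 : x * hard_core x U2 <= hard_core x U2 by rewrite ler_piMl ?hard_core_ge0.
apply: le_trans (lerD h1 (le_trans h3 h2)) _.
rewrite -mulrDl ler_wpM2r ?expR_ge0 //.
have u0 : 0 <= #|U|%:R :> R by rewrite ler0n.
(* Leaving [v] out keeps the budget [q.+1], taking it uses one unit; the two bounds add up to
   [#|U| ^+ q * (#|U| + 1)], below the claim. *)
have -> : #|U|%:R ^+ q.+1 + #|U|%:R ^+ q = #|U|%:R ^+ q * #|U|.+1%:R :> R.
  by rewrite -natr1 mulrDr mulr1 exprSr.
rewrite exprSr ler_wpM2r ?ler0n // lerXn2r ?nnegrE ?ler0n // ler_nat.
exact: leqnSn.
Qed.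

Lemma card_independent_le x t : 0 < x ->
  #|[set I : {set T} | independent I & #|I| == t]|%:R * x ^+ t
   <= hard_core x finset.setT.
Proof.
move=> x0; rewrite mulrC mulr_natr -sumr_const /hard_core.
rewrite [leRHS](bigID (fun I : {set T} => #|I| == t)) /=.
rewrite -[leLHS]addr0; apply: lerD.
  rewrite le_eqVlt; apply/orP; left; apply/eqP.
  apply: eq_big => [I|I]; first by rewrite inE finset.subsetT.
  by rewrite inE => /andP[_ /eqP->].
by apply: sumr_ge0 => I _; rewrite exprn_ge0 // ltW.
Qed.

End HardCore.

Lemma sqr_sum_le {R : realFieldType} (m : nat) (f : 'I_m -> R) :
  (\sum_i f i) ^+ 2 <= m%:R * \sum_i f i ^+ 2.
Proof.
case: m f => [|m] f; first by rewrite !big_ord0 mul0r expr0n.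
move: m.+1 (ltn0Sn m) f => {}m m0 f; set A := \sum_i f i; set B := \sum_i f i ^+ 2.
have mp : (0 : R) < m%:R by rewrite ltr0n.
have : 0 <= \sum_i (m%:R * f i - A) ^+ 2 by apply: sumr_ge0 => i _; exact: sqr_ge0.
have -> : \sum_i (m%:R * f i - A) ^+ 2 = m%:R ^+ 2 * B - 2 * m%:R * A * A + m%:R * A ^+ 2.
  transitivity (\sum_i (m%:R ^+ 2 * f i ^+ 2 - 2 * m%:R * A * f i + A ^+ 2)).
    by apply: eq_bigr => i _; ring.
  rewrite big_split /= sumrB -!mulr_sumr -/A -/B; congr (_ + _).
  by rewrite sumr_const card_ord mulrnAr -expr2 mulr_natl.
by move=> h; rewrite -(ler_pM2l mp); lra.
Qed.

(** * The graph attached to a Sidon set; [Z] is the number of possible sums [0, ..., 2n] *)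

Section SidonGraph.
Context {n : nat}.
Implicit Types (S U I : {set 'I_n.+1}) (x y z w : 'I_n.+1).
Local Notation Z := (n.*2.+1).

Definition sum_graph S : rel 'I_n.+1 := fun x y =>
  (x != y) && [exists a in S, exists b in S, (x + a == y + b)%N].

Lemma sum_graph_sym S : symmetric (sum_graph S).
Proof.
move=> x y; rewrite /sum_graph eq_sym; congr (_ && _).
by apply/exists_inP/exists_inP => -[a aS /exists_inP[b bS /eqP E]];
  exists b => //; apply/exists_inP; exists a => //; rewrite E.
Qed.

Lemma sum_graph_irr S : irreflexive (sum_graph S).
Proof. by move=> x; rewrite /sum_graph eqxx. Qed.

Lemma sum_cases S w x y z : sidon S -> w \in S -> x \in S -> y \in S -> z \in S ->
  (w + x = y + z)%N -> (w = y /\ x = z) \/ (w = z /\ x = y).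
Proof.
move=> /sidonP H wS xS yS zS E; have E2 := H _ _ _ _ wS xS yS zS E.
have : w \in [set y; z] by rewrite -E2 !inE eqxx.
rewrite !inE => /orP[] /eqP e; [left|right]; split => //; apply: val_inj => /=;
  move: E; rewrite e; lia.
Qed.

Lemma sidon_sub S S' : S \subset S' -> sidon S' -> sidon S.
Proof.
move=> /fintype.subsetP sub /sidonP H; apply/sidonP => w x y z wS xS yS zS.
by apply: H; apply: sub.
Qed.

Definition rep_count U S (k : nat) : nat := \sum_(x in U) \sum_(a in S) (x + a == k)%N.

Lemma sum_rep_count U S : (\sum_(k < Z) rep_count U S k = #|U| * #|S|)%N.
Proof.
rewrite /rep_count exchange_big /=.
under eq_bigr do rewrite exchange_big /=.
rewrite -sum_nat_const; apply: eq_bigr => x _; rewrite -sum1_card.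
apply: eq_bigr => a _.
have xa : (x + a < Z)%N by have := ltn_ord x; have := ltn_ord a; lia.
rewrite (bigD1 (Ordinal xa)) //= eqxx big1 ?addn0 // => k.
by rewrite -val_eqE /= eq_sym => /negbTE->.
Qed.

Lemma sum_rep_count_sqr U S : (\sum_(k < Z) rep_count U S k ^ 2 =
  \sum_(x in U) \sum_(y in U) \sum_(a in S) \sum_(b in S) (x + a == y + b)%N)%N.
Proof.
transitivity (\sum_(k < Z) \sum_(x in U) \sum_(y in U) \sum_(a in S) \sum_(b in S)
    ((x + a == k) * (y + b == k)))%N.
  apply: eq_bigr => k _; rewrite -mulnn /rep_count big_distrl /=.
  apply: eq_bigr => x _; rewrite big_distrr /=; apply: eq_bigr => y _.
  by rewrite big_distrl /=; apply: eq_bigr => a _; rewrite big_distrr.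
rewrite exchange_big /=; apply: eq_bigr => x _.
rewrite exchange_big /=; apply: eq_bigr => y _.
rewrite exchange_big /=; apply: eq_bigr => a _.
rewrite exchange_big /=; apply: eq_bigr => b _.
have xa : (x + a < Z)%N by have := ltn_ord x; have := ltn_ord a; lia.
rewrite (bigD1 (Ordinal xa)) //= eqxx mul1n big1 ?addn0 1?eq_sym // => k.
by rewrite -val_eqE /= eq_sym => /negbTE->; rewrite mul0n.
Qed.

(** For [x != y] a solution has the prescribed nonzero difference [a - b], which determines [(a, b)]
    in a Sidon set. Thus representations and edges correspond without multiplicity. *)
Lemma sum_pair_le S x y : sidon S ->
  (\sum_(a in S) \sum_(b in S) (x + a == y + b)%N <=
   (if x == y then #|S| else sum_graph S x y))%N.
Proof.
move=> Ssid; have [->|xy] := eqVneq x y.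
  rewrite -sum1_card; apply: leq_sum => a aS.
  rewrite (bigD1 a) //= eqxx big1 ?addn0 // => b /andP[_ ba].
  by rewrite eqn_add2l val_eqE eq_sym (negbTE ba).
rewrite /sum_graph xy /=; case: exists_inP => [[a0 a0S /exists_inP[b0 b0S /eqP E0]]|no].
  apply: (@leq_trans (\sum_(a in S) (a == a0))%N).
    apply: leq_sum => a aS; apply: (@leq_trans (\sum_(b in S) ((b == b0) * (a == a0)))%N).
      apply: leq_sum => b bS; case: eqP => // E.
      have /(sum_cases Ssid aS b0S a0S bS)[[-> ->]|[e _]] : (a + b0 = a0 + b)%N by lia.
        by rewrite !eqxx.
      by case/eqP: xy; apply: val_inj => /=; move: E; rewrite e; lia.
    by rewrite (bigD1 b0) //= eqxx mul1n big1 ?addn0 // => b /andP[_ /negbTE->].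
  by rewrite (bigD1 a0) //= eqxx big1 ?addn0 // => b /andP[_ /negbTE->].
rewrite big1 // => a aS; rewrite big1 // => b bS; case: eqP => // E.
by case: no; exists a => //; apply/exists_inP; exists b => //; apply/eqP.
Qed.

(** Each of the [Z] sums comes from at most two ordered pairs. *)
Lemma sidon_card_sqr S : sidon S -> (#|S| ^ 2 <= 2 * Z)%N.
Proof.
move=> Ssid; rewrite -mulnn -sum_rep_count -[X in (_ <= 2 * X)%N]card_ord mulnC -sum_nat_const.
apply: leq_sum => k _; rewrite /rep_count.
have [|no] := pselect (exists x0, exists2 a0, x0 \in S & a0 \in S /\ (x0 + a0 = k)%N).
  move=> [x0 [a0 x0S [a0S E0]]].
  apply: (@leq_trans (\sum_(x in S) ((x == x0) + (x == a0)))%N).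
    apply: leq_sum => x xS.
    apply: (@leq_trans (\sum_(a in S) ((a == a0) * (x == x0) + (a == x0) * (x == a0)))%N).
      apply: leq_sum => a aS; case: eqP => // E; rewrite -E0 in E.
      by have [[-> ->]|[-> ->]] := sum_cases Ssid xS aS x0S a0S E; rewrite !eqxx ?leq_addr ?leq_addl.
    rewrite big_split /= -!big_distrl /=.
    have one c : c \in S -> (\sum_(a in S) (a == c))%N = 1%N.
      by move=> cS; rewrite (bigD1 c) //= eqxx big1 ?addn0 // => b /andP[_ /negbTE->].
    by rewrite !one // !mul1n.
  have one c : c \in S -> (\sum_(a in S) (a == c))%N = 1%N.
    by move=> cS; rewrite (bigD1 c) //= eqxx big1 ?addn0 // => b /andP[_ /negbTE->].
  by rewrite big_split /= !one.
rewrite big1 // => x xS; rewrite big1 // => a aS; case: eqP => // E.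
by case: no; exists x, a.
Qed.

(** With [A = #|U| * #|S|] and [D] the sum of the degrees, Cauchy-Schwarz over the [Z] sums gives
    [A^2 <= Z (A + D)], where [A] is the diagonal. The hypothesis [A >= 2 Z] makes the diagonal at
    most half, so [D >= A^2 / (2 Z)], and some vertex reaches the average. *)
Lemma sum_graph_degree {R : realFieldType} S U : sidon S ->
  (2 * Z <= #|U| * #|S|)%N -> (0 < #|S|)%N ->
  exists2 v, v \in U &
    (#|S| ^ 2)%:R / (2 * Z)%:R * #|U|%:R <= #|[set w in U | sum_graph S v w]|%:R :> R.
Proof.
move=> Ssid big s0; set s := #|S| in big s0 *; set u := #|U| in big *.
have [//|no] := pselect (exists2 v, v \in U &
    (s ^ 2)%:R / (2 * Z)%:R * u%:R <= #|[set w in U | sum_graph S v w]|%:R :> R).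
exfalso.
have Zp : (0 : R) < Z%:R by rewrite ltr0n.
have u0 : (0 < u)%N by case: (u) big => //; rewrite mul0n.
have deg v : v \in U ->
    #|[set w in U | sum_graph S v w]|%:R < (s ^ 2)%:R / (2 * Z)%:R * u%:R :> R.
  by move=> vU; rewrite ltNge; apply/negP => h; apply: no; exists v.
have up : (\sum_(k < Z) rep_count U S k ^ 2 <=
    u * s + \sum_(x in U) #|[set w in U | sum_graph S x w]|)%N.
  rewrite sum_rep_count_sqr -[(u * s)%N]sum_nat_const -big_split /=.
  apply: leq_sum => x xU.
  apply: (@leq_trans (\sum_(y in U) ((x == y) * s + sum_graph S x y))%N).
    apply: leq_sum => y _; apply: leq_trans (sum_pair_le x y Ssid) _.
    by case: eqP => _; rewrite ?mul1n ?mul0n ?leq_addr.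
  rewrite big_split /= leq_add //.
    rewrite -big_distrl /= (bigD1 x) //= eqxx big1 ?addn0 ?mul1n // => y /andP[_].
    by rewrite eq_sym => /negbTE->.
  rewrite -sum1_card [leqRHS]big_mkcond [leqLHS]big_mkcond /=.
  apply: leq_sum => y _; rewrite inE; case: (y \in U) => //=.
have upR : (\sum_(x in U) #|[set w in U | sum_graph S x w]|)%N%:R <
    u%:R * ((s ^ 2)%:R / (2 * Z)%:R * u%:R) :> R.
  rewrite natr_sum mulr_natl -sumr_const; apply: ltr_sum => //.
  by have /card_gt0P[v vU] := u0; apply/hasP; exists v; rewrite ?mem_index_enum.
have cs := @sqr_sum_le R Z (fun k => (rep_count U S k)%:R).
rewrite -natr_sum sum_rep_count -/u -/s in cs.
have sq : \sum_(i < Z) (rep_count U S i)%:R ^+ 2 <=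
   (u * s)%:R + (\sum_(x in U) #|[set w in U | sum_graph S x w]|)%N%:R :> R.
  rewrite -natrD; apply: le_trans (_ : (\sum_(k < Z) rep_count U S k ^ 2)%N%:R <= _).
    by rewrite natr_sum; apply: ler_sum => k _; rewrite natrX.
  by rewrite ler_nat.
have us : 2 * Z%:R <= (u * s)%:R :> R by rewrite -natrM ler_nat.
have e1 : u%:R * ((s ^ 2)%:R / (2 * Z)%:R * u%:R) = (u * s)%:R ^+ 2 / (2 * Z%:R) :> R.
  by rewrite !natrM; field; rewrite gt_eqF.
rewrite e1 in upR; set D := (\sum_(x in U) _)%N%:R in sq upR.
set A := (u * s)%:R in us upR sq cs; set Q := \sum_(i < Z) _ in cs sq.
have h1 : D * (2 * Z%:R) < A ^+ 2 by rewrite -ltr_pdivlMr ?mulr_gt0.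
have A0 : 0 <= A by rewrite ler0n.
have h2 := ler_wpM2l (ltW Zp) sq.
have h3 := ler_wpM2l A0 us.
by rewrite expr2 in h1 cs; lra.
Qed.

Lemma extension_independent S S' : S \subset S' -> sidon S' ->
  independent (sum_graph S) (S' :\: S).
Proof.
move=> /fintype.subsetP sub Ssid; apply/independentP => x y.
rewrite !inE => /andP[xS xS'] /andP[yS yS']; apply/negP => /andP[xy].
case/exists_inP=> a aS /exists_inP[b bS /eqP E].
have [[e _]|[e _]] := sum_cases Ssid xS' (sub _ aS) yS' (sub _ bS) E.
  by rewrite e eqxx in xy.
by rewrite e bS in xS.
Qed.

Definition sidon_sets (k : nat) : {set {set 'I_n.+1}} :=
  [set S : {set 'I_n.+1} | sidon S & #|S| == k].

Lemma subset_of_card (T : finType) (A : {set T}) (k : nat) : (k <= #|A|)%N ->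
  exists2 B : {set T}, B \subset A & #|B| = k.
Proof.
move=> kA; have : (0 < #|[set B : {set T} | B \subset A & #|B| == k]|)%N.
  by rewrite cards_draws bin_gt0.
by case/card_gt0P => B; rewrite inE => /andP[BA /eqP Bk]; exists B.
Qed.

(** Every Sidon set of size [s + t] is the union of one of its subsets of size [s] and an
    independent set of that subset's graph. Only surjectivity of the union map matters, so any
    subset will do. *)
Lemma card_sidon_sets_extend {R : realFieldType} (M : R) (s t : nat) :
  (forall S, S \in sidon_sets s ->
     #|[set I : {set 'I_n.+1} | independent (sum_graph S) I & #|I| == t]|%:R <= M) ->
  #|sidon_sets (s + t)|%:R <= #|sidon_sets s|%:R * M.
Proof.
move=> HM.
pose P := [set p : {set 'I_n.+1} * {set 'I_n.+1} |
  (p.1 \in sidon_sets s) && (independent (sum_graph p.1) p.2 && (#|p.2| == t))].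
have sub : sidon_sets (s + t) \subset [set p.1 :|: p.2 | p in P].
  apply/fintype.subsetP => S'; rewrite inE => /andP[S'sid /eqP S'c].
  have [|S SS' Sc] := @subset_of_card _ S' s; first by rewrite S'c leq_addr.
  apply/imsetP; exists (S, S' :\: S); last first.
    by rewrite /= finset.setDE finset.setUIr finset.setUCr finset.setIT; apply/esym/finset.setUidPr.
  rewrite !inE /= (sidon_sub SS' S'sid) Sc eqxx extension_independent //=.
  by rewrite cardsD (finset.setIidPr SS') S'c Sc addKn.
apply: (@le_trans _ _ #|P|%:R).
  by rewrite ler_nat; apply: leq_trans (subset_leq_card sub) (leq_imset_card _ _).
have -> : #|P| = (\sum_(S in sidon_sets s)
    #|[set I : {set 'I_n.+1} | independent (sum_graph S) I & #|I| == t]|)%N.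
  under eq_bigr do rewrite -sum1_card.
  rewrite pair_big_dep /= -sum1_card; apply: eq_bigl => -[S I] /=.
  by rewrite !inE.
rewrite natr_sum mulr_natl -sumr_const; apply: ler_sum => S; exact: HM.
Qed.

End SidonGraph.

(** * Counting Sidon sets of a given size by doubling *)

Section UpperBound.
Context {R : realType}.

Lemma bin_le_expn (m k : nat) : ('C(m, k) <= m ^ k)%N.
Proof.
elim: m k => [|m IH] [|k]; rewrite ?bin0 ?expn0 // binS.
have mono : (m ^ k <= m.+1 ^ k)%N by case: (k) => // j; rewrite leq_exp2r.
have := IH k; have := IH k.+1; rewrite !expnS; nia.
Qed.

Lemma sqrt_le_scale (c a b : R) : 0 <= c -> 0 <= b -> a <= c ^+ 2 * b ->
  Num.sqrt a <= c * Num.sqrt b.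
Proof.
move=> c0 b0 h; rewrite -[c in leRHS](ger0_norm c0) -sqrtr_sqr -sqrtrM ?sqr_ge0 //.
exact: ler_wsqrtr.
Qed.

(* The activity [x = t s / (4 Z)] of the hard-core model is, up to a factor [2],
   the one that balances [x ^- t] against [exp (x r)], where [r = 2 Z / s]. *)
Lemma card_sidon_extensions (n s t q : nat) (S : {set 'I_n.+1}) :
  let f : R := Num.sqrt (Num.sqrt n.+1%:R) in
  S \in sidon_sets s -> (0 < s)%N -> (0 < t <= s.+1)%N ->
  ln n.+1%:R <= (s ^ 2)%:R / (2 * n.*2.+1)%:R * q%:R :> R ->
  #|[set I : {set 'I_n.+1} | independent (sum_graph S) I & #|I| == t]|%:R <=
    n.+2%:R ^+ q * expR (8 * f * Num.sqrt t%:R).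
Proof.
move=> f; rewrite inE => /andP[Ssid /eqP Sc] s0 /andP[t0 ts] hq.
set N : R := n.+1%:R in f hq *; pose Z : R := n.*2.+1%:R.
have s2 := sidon_card_sqr Ssid; rewrite Sc in s2.
have sp : (1 : R) <= s%:R by rewrite ler1n.
have tp : (1 : R) <= t%:R by rewrite ler1n.
have ts' : t%:R <= s%:R + 1 :> R by rewrite natr1 ler_nat.
have Zp : 0 < Z by rewrite ltr0n.
have ZN : Z <= 2 * N by rewrite -natrM ler_nat; lia.
have N1 : 1 <= N by rewrite ler1n.
have s2' : s%:R ^+ 2 <= 2 * Z :> R by rewrite -natrX -natrM ler_nat.
have E2 : (2 * n.*2.+1)%:R = 2 * Z :> R by rewrite natrM.
have s2e : (s ^ 2)%:R = s%:R ^+ 2 :> R by rewrite natrX.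
set x : R := t%:R * s%:R / (4 * Z); set r : R := 2 * Z / s%:R.
set beta : R := (s ^ 2)%:R / (2 * n.*2.+1)%:R.
have ss : s%:R <= s%:R ^+ 2 :> R by rewrite expr2 ler_peMr //; lra.
have x0 : 0 < x by rewrite /x divr_gt0 ?mulr_gt0 //; lra.
have x1 : x <= 1.
  rewrite /x ler_pdivrMr ?mulr_gt0 // mul1r.
  have : t%:R * s%:R <= (s%:R + 1) * s%:R :> R by rewrite ler_wpM2r.
  rewrite mulrDl mul1r -expr2; lra.
have b0 : 0 <= beta by rewrite divr_ge0.
have b1 : beta <= 1 by rewrite /beta E2 s2e ler_pdivrMr ?mulr_gt0 // mul1r.
have r1 : 1 <= r by rewrite /r ler_pdivlMr; lra.
have deg (V : {set 'I_n.+1}) : r < #|V|%:R ->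
    exists2 v, v \in V & beta * #|V|%:R <= #|[set w in V | sum_graph S v w]|%:R.
  move=> rV; rewrite /beta -Sc; apply: sum_graph_degree; rewrite ?Sc //.
  rewrite -(ler_nat R) [X in _ <= X]natrM E2 ltW //.
  by rewrite -ltr_pdivrMr //; lra.
have dec : #|[set: 'I_n.+1]|%:R * (1 - beta) ^+ q <= r.
  rewrite cardsT card_ord -/N; apply: le_trans r1.
  have h : (1 - beta) ^+ q <= expR (- (beta * q%:R)).
    have -> : - (beta * q%:R) = q%:R * - beta by rewrite mulrN mulrC.
    rewrite expRM_natl.
    by apply: lerXn2r; rewrite ?nnegrE ?expR_ge0 ?expR_ge1Dx // subr_ge0.
  apply: (@le_trans _ _ (N * expR (- (beta * q%:R)))).
    by rewrite ler_wpM2l //; lra.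
  rewrite -{1}[N]lnK ?posrE; last by lra.
  by rewrite -expRD expR_le1 subr_le0.
have := hard_core_bound (@sum_graph_sym n S) (@sum_graph_irr n S)
   (x := x) (beta := beta) (r := r) (q := q) (U := [set: 'I_n.+1]).
rewrite x1 b0 b1 (ltW x0) => /(_ isT isT deg dec).
have cT : #|[set: 'I_n.+1]|.+1 = n.+2 by rewrite cardsT card_ord.
rewrite cT => hb.
have ci := card_independent_le (sum_graph S) t x0.
have xt0 : 0 < x ^+ t by rewrite exprn_gt0.
have {ci hb}main := le_trans ci hb.
have xr : x * r = t%:R / 2 by rewrite /x /r; field; rewrite !gt_eqF //; lra.
rewrite -(ler_pM2r xt0); apply: le_trans main _; rewrite xr -[leRHS]mulrA ler_wpM2l ?exprn_ge0 //.
set w := Num.sqrt t%:R.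
have w0 : 0 < w by rewrite sqrtr_gt0; lra.
have w2 : w ^+ 2 = t%:R by rewrite sqr_sqrtr //; lra.
have f2 : f ^+ 2 = Num.sqrt N by rewrite sqr_sqrtr ?sqrtr_ge0.
have f4 : f ^+ 4 = N by rewrite (exprM f 2 2) f2 sqr_sqrtr //; lra.
(* Since [Z <= 2 N] and [t <= 2 s], [1 / x <= 16 N / t^2 = (2 f / w)^4]. Then [y <= exp (y - 1)]
   with [y = 2 f / w], raised to the power [4 t = 4 w^2], produces the exponent [8 f w]; its
   negative part absorbs [x * r = t / 2]. *)
have xi : x^-1 <= expR (4 * (2 * f / w - 1)).
  have h1 : x^-1 <= (2 * f / w) ^+ 4.
    have tp0 : (0 : R) < t%:R by rewrite ltr0n.
    have sp0 : (0 : R) < s%:R by rewrite ltr0n.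
    rewrite /x invf_div (ler_pdivrMr _ _ (mulr_gt0 tp0 sp0)).
    have -> : (2 * f / w) ^+ 4 * (t%:R * s%:R) = 16 * f ^+ 4 * s%:R / t%:R.
      by rewrite -w2; field; rewrite gt_eqF.
    rewrite f4 ler_pdivlMr; last by lra.
    by have := ler_pM2l Zp t%:R (2 * s%:R); nra.
  apply: le_trans h1 _; rewrite expRM_natl.
  have f0 : 0 <= f by exact: sqrtr_ge0.
  have := expR_ge1Dx (2 * f / w - 1); rewrite addrC subrK => h.
  by rewrite lerXn2r ?nnegrE ?expR_ge0 // divr_ge0 ?mulr_ge0 // ltW.
have xit : (x^-1) ^+ t <= expR (t%:R * (4 * (2 * f / w - 1))).
  by rewrite expRM_natl lerXn2r ?nnegrE ?expR_ge0 // invr_ge0 ltW.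
rewrite exprVn in xit.
have : expR (t%:R / 2) * (x ^+ t)^-1 <= expR (8 * f * w).
  apply: (@le_trans _ _ (expR (t%:R / 2) * expR (t%:R * (4 * (2 * f / w - 1))))).
    by rewrite ler_wpM2l ?expR_ge0.
  rewrite -expRD ler_expR -w2.
  have -> : w ^+ 2 / 2 + w ^+ 2 * (4 * (2 * f / w - 1)) = 8 * f * w - 7 / 2 * w ^+ 2.
    by field; rewrite gt_eqF.
  have := sqr_ge0 w; lra.
by rewrite ler_pdivrMr.
Qed.

End UpperBound.

Section UpperBoundSum.
Context {R : realType}.

Lemma card_sidon_sets_small (n s s0 : nat) : (s < s0)%N ->
  #|@sidon_sets n s|%:R <= n.+2%:R ^+ s0 :> R.
Proof.
move=> ss; rewrite -natrX ler_nat.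
apply: (@leq_trans 'C(n.+1, s)).
  have -> : 'C(n.+1, s) = 'C(#|[set: 'I_n.+1]|, s) by rewrite cardsT card_ord.
  rewrite -cards_draws; apply: subset_leq_card.
  by apply/fintype.subsetP => S; rewrite !inE => /andP[_ ->]; rewrite finset.subsetT.
apply: leq_trans (bin_le_expn _ _) _; apply: (@leq_trans (n.+2 ^ s)).
  by case: (s) => // k; rewrite leq_exp2r.
by rewrite leq_exp2l // ltnW.
Qed.

(** A set of size [s] is reached from one of size [h = s./2] at the cost of [exp (8 f sqrt t)] and
    one factor [n.+2 ^+ Q]. The fractions [29/41] and [5/7] bound [sqrt 1/2] from above, the second
    with room for the rounding up in [t] when [s >= 100]; the induction closes because
    [20 * 29/41 + 8 * 5/7 < 20]. *)
Lemma card_sidon_sets_le (n s0 Q k s : nat) : (100 <= s0)%N ->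
  (forall h, (s0 <= h.*2.+1)%N ->
     ln n.+1%:R <= (h ^ 2)%:R / (2 * n.*2.+1)%:R * Q%:R :> R) ->
  (s < 2 ^ k * s0)%N ->
  #|@sidon_sets n s|%:R <= n.+2%:R ^+ (s0 + k * Q) *
     expR (20 * Num.sqrt (Num.sqrt n.+1%:R) * Num.sqrt s%:R) :> R.
Proof.
move=> s100 HQ; set f : R := Num.sqrt (Num.sqrt n.+1%:R).
have f0 : 0 <= f by exact: sqrtr_ge0.
have n1 : 1 <= n.+2%:R :> R by rewrite ler1n.
have small k' s' : (s' < s0)%N -> #|@sidon_sets n s'|%:R <=
    n.+2%:R ^+ (s0 + k' * Q) * expR (20 * f * Num.sqrt s'%:R) :> R.
  move=> /(card_sidon_sets_small n) h; apply: le_trans h _.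
  apply: (@le_trans _ _ (n.+2%:R ^+ (s0 + k' * Q))).
    by apply: ler_weXn2l => //; rewrite leq_addr.
  rewrite ler_peMr ?exprn_ge0 // leNgt expR_lt1 -leNgt.
  by rewrite !mulr_ge0 // sqrtr_ge0.
elim: k s => [|k IH] s; first by rewrite mul1n; exact: small.
move=> sk; have [ss|ss] := ltnP s s0; first exact: small.
set h := s./2; set t := (s - h)%N.
have Eht : (h + t = s)%N by rewrite /t subnKC // /h; lia.
have h0 : (0 < h)%N by rewrite /h; lia.
have ht : (0 < t <= h.+1)%N by apply/andP; split; rewrite /t /h; lia.
have hk : (h < 2 ^ k * s0)%N by move: sk; rewrite expnS /h; lia.
have hQ := HQ h; rewrite (_ : (s0 <= h.*2.+1)%N) in hQ; last by rewrite /h; lia.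
have ext := @card_sidon_sets_extend n R _ h t
  (fun S SA => card_sidon_extensions SA h0 ht (hQ isT)).
rewrite Eht in ext; apply: le_trans ext _.
apply: le_trans (ler_wpM2r _ (IH h hk)) _; first by rewrite mulr_ge0 ?exprn_ge0 ?expR_ge0.
rewrite mulrACA -exprD -expRD mulSn.
have -> : (s0 + k * Q + Q = s0 + (Q + k * Q))%N by lia.
rewrite ler_wpM2l ?exprn_ge0 // ler_expR -/f.
have sq1 : Num.sqrt h%:R <= 29 / 41 * Num.sqrt s%:R :> R.
  apply: sqrt_le_scale => //.
  have : h%:R * 2 <= s%:R :> R by rewrite -natrM ler_nat /h; lia.
  have : 0 <= h%:R :> R by rewrite ler0n.
  rewrite expr2; lra.
have sq2 : Num.sqrt t%:R <= 5 / 7 * Num.sqrt s%:R :> R.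
  apply: sqrt_le_scale => //.
  have : t%:R * 100 <= s%:R * 51 :> R by rewrite -!natrM ler_nat /t /h; lia.
  have : 0 <= t%:R :> R by rewrite ler0n.
  rewrite expr2; lra.
have sq0 : 0 <= Num.sqrt s%:R :> R by exact: sqrtr_ge0.
have a1 := ler_wpM2l f0 sq1; have a2 := ler_wpM2l f0 sq2.
have a3 : 0 <= f * Num.sqrt s%:R by rewrite mulr_ge0.
lra.
Qed.

(** A Sidon set has size [s <= 2 sqrt N], so [sqrt s <= 17/12 N^(1/4)], and [20 * 17/12 < 29]. The
    sum over the [n.+2] sizes adds one to the exponent of [n.+2]. *)
Lemma num_sidon_le (n s0 Q k : nat) : (100 <= s0)%N ->
  (forall h, (s0 <= h.*2.+1)%N ->
     ln n.+1%:R <= (h ^ 2)%:R / (2 * n.*2.+1)%:R * Q%:R :> R) ->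
  (n.+1 < 2 ^ k * s0)%N ->
  (num_sidon n)%:R <= n.+2%:R ^+ (s0 + k * Q).+1 *
     expR (29 * Num.sqrt n.+1%:R) :> R.
Proof.
move=> s100 HQ nk; set N : R := n.+1%:R.
have N0 : 0 <= N by rewrite ler0n.
set X : R := n.+2%:R ^+ (s0 + k * Q) * expR (29 * Num.sqrt N).
have X0 : 0 <= X by rewrite mulr_ge0 ?exprn_ge0 ?expR_ge0.
have part : (num_sidon n <= \sum_(s < n.+2) #|@sidon_sets n s|)%N.
  apply: (@leq_trans #|[set S : {set 'I_n.+1} | sidon S]|).
    by apply: subset_leq_card; apply/fintype.subsetP => S; rewrite !inE => /andP[].
  rewrite -sum1_card (partition_big (fun S : {set 'I_n.+1} => inord #|S| : 'I_n.+2) predT) //=.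
  apply: leq_sum => s _; rewrite -sum1_card [leqRHS]big_mkcond [leqLHS]big_mkcond /=.
  apply: leq_sum => S _; rewrite !inE; case: (sidon S) => //=.
  case: eqP => // <-; rewrite inordK ?eqxx //.
  by rewrite ltnS -[X in (_ <= X)%N](card_ord n.+1) max_card.
apply: (@le_trans _ _ (\sum_(s < n.+2) X)); last first.
  by rewrite sumr_const card_ord -[X *+ _]mulr_natl /X mulrA -exprS.
apply: (@le_trans _ _ ((\sum_(s < n.+2) #|@sidon_sets n s|)%N%:R)); first by rewrite ler_nat.
rewrite natr_sum; apply: ler_sum => s _.
have [->|] := posnP #|@sidon_sets n s|; first by [].
case/card_gt0P=> S; rewrite inE => /andP[Ssid /eqP Sc].
have s2 := sidon_card_sqr Ssid; rewrite Sc in s2.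
have sk : (s < 2 ^ k * s0)%N by apply: leq_ltn_trans nk; rewrite -ltnS.
apply: le_trans (card_sidon_sets_le s100 HQ sk) _.
rewrite /X ler_wpM2l ?exprn_ge0 // ler_expR -/N.
have sN : s%:R <= 2 * Num.sqrt N :> R.
  have -> : s%:R = Num.sqrt (s%:R ^+ 2) :> R by rewrite sqrtr_sqr ger0_norm.
  apply: sqrt_le_scale => //.
  rewrite -natrX; have : (s ^ 2)%:R <= 4 * N :> R by rewrite -natrM ler_nat; lia.
  by rewrite [2 ^+ 2]expr2; lra.
have : Num.sqrt s%:R <= 17 / 12 * Num.sqrt (Num.sqrt N).
  apply: sqrt_le_scale; rewrite ?sqrtr_ge0 //.
  have := sqrtr_ge0 N; rewrite expr2; lra.
set f := Num.sqrt (Num.sqrt N).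
have f0 : 0 <= f by exact: sqrtr_ge0.
have f2 : f ^+ 2 = Num.sqrt N by rewrite sqr_sqrtr ?sqrtr_ge0.
move=> /(ler_wpM2l f0); rewrite mulrCA -expr2 f2; have := sqrtr_ge0 N.
lra.
Qed.

(** With [z = N^(1/16)], logarithms are [O(z)], and the polynomial factors contribute
    [O(z^6) * O(z)], which is below [z^8 = sqrt N] once [z >= 88 * 100 * 17]. Then [29 + 1] times
    [sqrt N <= sqrt n + 1] stays below [34 sqrt n]. *)
Lemma num_sidon_upper : exists n0 : nat, forall n, (n0 <= n)%N ->
  (num_sidon n)%:R <= expR (34 * Num.sqrt n%:R) :> R.
Proof.
have [n1 Hn1] := natr_eventually_ge ((88 * 100 * 17) ^+ 16 : R).
exists n1 => n nn; set N : R := n.+1%:R.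
have Nbig : (88 * 100 * 17) ^+ 16 <= N by apply: Hn1; exact: leqW.
pose z := Num.sqrt (Num.sqrt (Num.sqrt (Num.sqrt N))).
have z0 : 0 <= z by exact: sqrtr_ge0.
have N0 : 0 <= N by rewrite ler0n.
have z8 : z ^+ 8 = Num.sqrt N.
  by rewrite (exprM z 2 4) sqr_sqrtr ?sqrtr_ge0 // (exprM _ 2 2) sqr_sqrtr ?sqrtr_ge0 // sqr_sqrtr ?sqrtr_ge0.
have z16 : z ^+ 16 = N by rewrite (exprM z 8 2) z8 sqr_sqrtr.
have zbig : 88 * 100 * 17 <= z by rewrite -(@ler_pXn2r R 16 isT) ?nnegrE // z16.
have z1 : 1 <= z by lra.
have zp : 0 < z by apply: lt_le_trans z1.
have lz : ln z <= z - 1 by exact: ln_leB1.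
have lN : ln N <= 16 * z.
  have -> : ln N = 16 * ln z by rewrite -z16 lnXn // mulr_natl.
  lra.
have lN1 : ln n.+2%:R <= 17 * z.
  have /andP[_] := @lnS_bound R n.+1 isT; rewrite -/N.
  have : n.+1%:R^-1 <= 1 :> R by rewrite invf_le1 ?ltr0n // ler1n.
  set a := _^-1; lra.
(* From [h >= z^6 / 2], [2 (2n + 1) <= 4 z^16] and [ln N <= 16 z], the condition on [Q] becomes
   [Q >= 256 z^5]. The summand 100 serves the rounding in the doubling. *)
pose s0 := (Num.truncn (z ^+ 6) + 100)%N.
pose Q := (Num.truncn (256 * z ^+ 5)).+1.
pose k := (trunc_log 2 n.+1).+1.
have z60 : 0 <= z ^+ 6 by rewrite exprn_ge0.
have z50 : 0 <= z ^+ 5 by rewrite exprn_ge0.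
have s0a : s0%:R <= z ^+ 6 + 100 by rewrite natrD lerD2r truncn_le.
have s0b : z ^+ 6 + 99 <= s0%:R.
  by have := ltW (truncnS_gt (z ^+ 6)); rewrite /s0 -natr1 natrD; lra.
have Qa : Q%:R <= 256 * z ^+ 5 + 1.
  have -> : Q%:R = (Num.truncn (256 * z ^+ 5))%:R + 1 :> R by rewrite natr1.
  by rewrite lerD2r truncn_le mulr_ge0 ?ler0n.
have Qb : 256 * z ^+ 5 <= Q%:R by exact/ltW/truncnS_gt.
have ka : k%:R <= 33 * z.
  have : (2 ^ trunc_log 2 n.+1 <= n.+1)%N by apply: trunc_logP.
  rewrite -(ler_nat R) natrX => h.
  have {}h : ln (2 ^+ trunc_log 2 n.+1) <= ln N by rewrite ler_ln // posrE ?exprn_gt0 ?ltr0n.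
  rewrite lnXn // -[ln 2 *+ _]mulr_natl in h.
  have := ler_wpM2l (ler0n R (trunc_log 2 n.+1)) (@ln2_ge_half R).
  have -> : k%:R = (trunc_log 2 n.+1)%:R + 1 :> R by rewrite natr1.
  lra.
have kb : (n.+1 < 2 ^ k * s0)%N.
  apply: (@leq_trans (2 ^ k)); first by apply: trunc_log_ltn.
  by rewrite leq_pmulr // /s0 addn_gt0 orbT.
have HQ h : (s0 <= h.*2.+1)%N -> ln N <= (h ^ 2)%:R / (2 * n.*2.+1)%:R * Q%:R.
  move=> sh; have hz : z ^+ 6 <= 2 * h%:R.
    have : s0%:R <= h.*2.+1%:R :> R by rewrite ler_nat.
    rewrite -addn1 natrD -muln2 natrM; lra.
  have h2 : z ^+ 12 <= 4 * (h ^ 2)%:R.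
    have := ler_pM z60 z60 hz hz; rewrite -exprD natrX expr2; lra.
  have Z4n : (2 * n.*2.+1 <= 4 * n.+1)%N by clear; lia.
  have Z4 : (2 * n.*2.+1)%:R <= 4 * N by rewrite -natrM ler_nat.
  have Zp : 0 < (2 * n.*2.+1)%:R :> R by rewrite ltr0n.
  apply: le_trans lN _.
  rewrite mulrAC ler_pdivlMr //.
  apply: (@le_trans _ _ (16 * z * (4 * z ^+ 16))).
    by rewrite z16 ler_wpM2l // mulr_ge0.
  apply: (@le_trans _ _ (z ^+ 12 / 4 * (256 * z ^+ 5))).
    have -> : z ^+ 12 / 4 * (256 * z ^+ 5) = 64 * z ^+ 17 by field.
    by have -> : 16 * z * (4 * z ^+ 16) = 64 * z ^+ 17 by ring.
  have q1 : 0 <= z ^+ 12 / 4 by rewrite divr_ge0 ?exprn_ge0 ?ler0n.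
  have q2 : 0 <= 256 * z ^+ 5 by rewrite mulr_ge0 ?ler0n.
  have q3 : z ^+ 12 / 4 <= (h ^ 2)%:R by rewrite ler_pdivrMr ?ltr0n // mulrC.
  exact: ler_pM q1 q2 q3 Qb.
have s100 : (100 <= s0)%N by rewrite leq_addl.
apply: le_trans (num_sidon_le s100 HQ kb) _.
rewrite -[n.+2%:R]lnK ?posrE ?ltr0n // -expRM_natl -expRD ler_expR -/N -z8.
have z61 : 1 <= z ^+ 6 by rewrite exprn_ege1.
have expo : (s0 + k * Q).+1%:R <= 88 * 100 * z ^+ 6.
  have kQ : k%:R * Q%:R <= 33 * z * (257 * z ^+ 5).
    apply: ler_pM => //; apply: le_trans Qa _.
    have : 1 <= z ^+ 5 by rewrite exprn_ege1.
    lra.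
  have e : 33 * z * (257 * z ^+ 5) = 33 * 257 * z ^+ 6 by ring.
  have -> : (s0 + k * Q).+1%:R = s0%:R + k%:R * Q%:R + 1 :> R.
    by rewrite -natrM -natrD natr1.
  lra.
have ln20 : 0 <= ln n.+2%:R :> R by exact: ln_natr_ge0.
have err : (s0 + k * Q).+1%:R * ln n.+2%:R <= z ^+ 8.
  apply: (@le_trans _ _ (88 * 100 * z ^+ 6 * (17 * z))); first exact: ler_pM.
  have -> : 88 * 100 * z ^+ 6 * (17 * z) = z ^+ 7 * (88 * 100 * 17) by ring.
  rewrite (exprSr z 7) ler_wpM2l ?exprn_ge0 //; lra.
have root : z ^+ 8 <= Num.sqrt n%:R + 1.
  rewrite z8 -(@ler_pXn2r R 2 isT) ?nnegrE ?sqrtr_ge0 ?addr_ge0 ?sqrtr_ge0 //.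
  rewrite sqr_sqrtr // sqrrD sqr_sqrtr ?ler0n // expr1n mulr1.
  have -> : N = n%:R + 1 by rewrite natr1.
  have := sqrtr_ge0 (n%:R : R); rewrite mulr2n; lra.
have z8b : 88 * 100 * 17 <= z ^+ 8.
  by apply: le_trans zbig _; rewrite ler_eXnr.
lra.
Qed.

End UpperBoundSum.

(** * Trivial bounds for small [n], and the passage to powers of 2 *)

Lemma num_sidon_gt0 (n : nat) : (0 < num_sidon n)%N.
Proof.
apply/card_gt0P; exists finset.set0; rewrite inE finset.sub0set /=.
by apply/sidonP => w x y z; rewrite finset.in_set0.
Qed.

Lemma num_sidon_le_exp2 (n : nat) : (num_sidon n <= 2 ^ n)%N.
Proof.
have E : #|interval1 n| = n.
  have -> : interval1 n = [set~ ord0]%SET by apply/finset.setP => i; rewrite !inE lt0n.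
  by rewrite cardsC1 card_ord.
rewrite -[X in (2 ^ X)%N]E -card_powerset; apply: subset_leq_card.
by apply/fintype.subsetP => S; rewrite !inE => /andP[].
Qed.

Local Open Scope classical_set_scope.

Theorem theorem1p10 (R : realType) :
  exists lo up : nat -> R,
    [/\ lo n @[n --> \oo] --> (0 : R),
        up n @[n --> \oo] --> (0 : R)
      & forall n : nat,
          2 `^ ((116 / 100 + lo n) * Num.sqrt n%:R) <= (num_sidon n)%:R
          /\ (num_sidon n)%:R <= 2 `^ ((55 + up n) * Num.sqrt n%:R)].
Proof.
have [n0 lower] := @num_sidon_lower R; have [n1 upper] := @num_sidon_upper R.
(* The error terms vanish for large [n]. Below the thresholds, [- 116/100] makes the lower exponent
   0, and [n] makes the upper one exceed the trivial [2 ^ n]. *)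
exists (fun n => if (n < n0)%N then - (116 / 100) else 0).
exists (fun n => if (n < n1)%N then n%:R else 0).
split.
- apply: cvg_near_cst; exists n0 => // n /= nn.
  by rewrite ltnNge nn.
- apply: cvg_near_cst; exists n1 => // n /= nn.
  by rewrite ltnNge nn.
move=> n; have powE (y : R) : 2 `^ y = expR (y * ln 2).
  by rewrite /powR pnatr_eq0.
have l2 := @ln2_lower R.
have l0 : 0 <= ln 2 :> R by lra.
have s0 : 0 <= Num.sqrt n%:R :> R by exact: sqrtr_ge0.
split.
  case: ltnP => nn; first by rewrite subrr mul0r powRr0 ler1n num_sidon_gt0.
  by rewrite addr0 powE; exact: lower.
case: ltnP => nn; last first.
  rewrite addr0 powE; apply: le_trans (upper n nn) _; rewrite ler_expR.
  have := ler_wpM2l s0 l2; lra.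
apply: (@le_trans _ _ (2 ^ n)%N%:R); first by rewrite ler_nat num_sidon_le_exp2.
rewrite natrX -powR_mulrn // ler_powR ?ler1n //.
have [->|n_gt0] := posnP n; first by rewrite sqrtr0 mulr0.
have s1 : 1 <= Num.sqrt n%:R :> R by rewrite -[leLHS]sqrtr1 ler_wsqrtr ?ler1n.
have : n%:R <= n%:R * Num.sqrt n%:R :> R by rewrite ler_peMr.
lra.
Qed.
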